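(* Let $\mathsf{T}$ be a p-string of length $n$ over $\Sigma_s \cup \Sigma_p$ with $\mathsf{T}[n] = \$$, and let $\mathsf{L}$ be the pBWT of $\mathsf{T}$. Given $\mathsf{L}$ only, one can compute in $O(n^3)$ time and $O(n^2)$ space a p-string that p-matches $\mathsf{T}$.
   Context: Let $\Sigma_s$ (static symbols) and $\Sigma_p$ (parameter symbols) be disjoint finite ordered alphabets. $\Sigma_s$ is disjoint from the integers, and every s-symbol is smaller than every integer. A p-string is a string over $\Sigma_s\cup\Sigma_p$. Two p-strings $x,y$ p-match if $y$ is obtained from $x$ by applying a bijection of $\Sigma_p$ to every occurrence of a p-symbol in $x$ (s-symbols are unchanged). The prev-encoding $\langle w\rangle$ of a p-string $w$ of length $m$ is the string of length $m$ with $\langle w\rangle[i]=w[i]$ if $w[i]\in\Sigma_s$; $\langle w\rangle[i]=0$ if $w[i]\in\Sigma_p$ does not occur in $w[1..i-1]$; and $\langle w\rangle[i]=i-j$ otherwise, where $j$ is the largest position in $[1..i-1]$ with $w[j]=w[i]$. Write $\mathrm{zeros}(X)$ for the number of occurrences of $0$ in $X$. Strings are compared lexicographically, with a proper prefix smaller than any extension. $\mathsf{T}$ is a p-string of length $n$ with $\mathsf{T}[n]=\$$, where $\$$ is the smallest s-symbol and does not occur elsewhere in $\mathsf{T}$. For an integer $i$, $\mathsf{T}_i=\mathsf{T}[i'..n]\mathsf{T}[1..i'-1]$, where $i'\in[1..n]$ and $i'\equiv i \pmod n$. Let $\tau$ be the permutation of $[1..n]$ such that $\langle \mathsf{T}_{\tau[i]}\rangle$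 is the $i$-th lexicographically smallest string among $\{\langle \mathsf{T}_{i'}\rangle\}_{i'=1}^n$. The pBWT of $\mathsf{T}$ is the string $\mathsf{L}$ of length $n$ defined by: - $\mathsf{L}[i]=\mathsf{T}_{\tau[i]}[n]$ if $\mathsf{T}_{\tau[i]}[n]\in\Sigma_s$; - otherwise $\mathsf{L}[i]=\mathrm{zeros}(\langle \mathsf{T}_{\tau[i]}[1..j]\rangle)$, where $j$ is the smallest position with $\mathsf{T}_{\tau[i]}[j]=\mathsf{T}_{\tau[i]}[n]$. Time is measured on a word RAM, and space in machine words. *)

(* Defs.v *)
(* Positions are 0-based throughout: the position i of the
   mathematical text is the index i - 1 here. *)
From HB Require Import structures.
From mathcomp Require Import all_boot all_order.

Set Implicit Arguments.
Unset Strict Implicit.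
Unset Printing Implicit Defensive.

Section PStrings.
Variables (ds dp : Order.disp_t) (Ss : finOrderType ds) (Sp : finOrderType dp).

Definition psym : Type := (Ss + Sp)%type.

(* The alphabet of prev-encodings and of the pBWT: s-symbols and integers. *)
Definition ecode : Type := (Ss + nat)%type.

Definition psubst (f : Sp -> Sp) (c : psym) : psym :=
  match c with inl s => inl s | inr p => inr (f p) end.

Definition pmatch (x y : seq psym) : Prop :=
  exists2 f : Sp -> Sp, bijective f & y = map (psubst f) x.

Definition prev_sym (w : seq psym) (i : nat) (c : psym) : ecode :=
  match c with
  | inl s => inl s
  | inr _ => if c \in take i w
             then inr (i - \max_(j < i | nth c w j == c) (j : nat))
             else inr 0
  end.

Definition prev_enc (w : seq psym) : seq ecode :=
  [seq prev_sym w i (tnth (in_tuple w) i) | i : 'I_(size w)].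

Definition zeros (X : seq ecode) : nat := count_mem (inr 0) X.

Definition ecode_lt (x y : ecode) : bool :=
  match x, y with
  | inl a, inl b => (a < b)%O
  | inl _, inr _ => true
  | inr _, inl _ => false
  | inr k, inr l => k < l
  end.

Fixpoint lex_le (X Y : seq ecode) : bool :=
  match X, Y with
  | [::], _ => true
  | _ :: _, [::] => false
  | x :: X', y :: Y' => ecode_lt x y || (x == y) && lex_le X' Y'
  end.

(* [rot i T] is the rotation T_{i+1}; the list below is tau, with its entries
   shifted by one. *)
Definition rot_order (T : seq psym) : seq nat :=
  sort (fun i j => lex_le (prev_enc (rot i T)) (prev_enc (rot j T)))
       (iota 0 (size T)).

Definition pbwt_sym (w : seq psym) (c : psym) : ecode :=
  match c with
  | inl s => inl s
  | inr _ => inr (zeros (prev_enc (take (index c w).+1 w)))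
  end.

(* [last x w] is the last symbol of w; the default x is irrelevant because the
   rotations of T are nonempty whenever [rot_order T] is. *)
Definition pbwt (x : psym) (T : seq psym) : seq ecode :=
  [seq (let w := rot i T in pbwt_sym w (last x w)) | i <- rot_order T].

End PStrings.

Arguments psym {ds dp} Ss Sp.
Arguments ecode {ds} Ss.

(* Word RAM with w-bit words. A program is a fixed finite list of unit-cost
   instructions, chosen independently of w; it halts when the program counter
   leaves the list. Registers are unboundedly indexed, but a given program
   mentions only finitely many of them. *)

Inductive binop : Type :=
  | OAdd | OSub | OMul | ODiv | OMod
  | OAnd | OOr | OXor | OShl | OShr | OLt | OEq.

Inductive instr : Type :=
  | IConst (r c : nat)                  (* r := c *)
  | IOp (o : binop) (r a b : nat)       (* r := a o b *)
  | ILoad (r a : nat)                   (* r := M[a] *)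
  | IStore (a r : nat)                  (* M[a] := r *)
  | IJz (r l : nat).                    (* if r = 0 goto l *)

Record state : Type := State { pc : nat; regs : nat -> nat; memory : nat -> nat }.

Definition upd (f : nat -> nat) (a v : nat) : nat -> nat :=
  fun x => if x == a then v else f x.

Definition eval_op (w : nat) (o : binop) (x y : nat) : nat :=
  match o with
  | OAdd => x + y
  | OSub => x + (2 ^ w - y)
  | OMul => x * y
  | ODiv => x %/ y
  | OMod => x %% y
  | OAnd => Nat.land x y
  | OOr => Nat.lor x y
  | OXor => Nat.lxor x y
  | OShl => x * 2 ^ y
  | OShr => x %/ 2 ^ y
  | OLt => x < y
  | OEq => x == y
  end %% 2 ^ w.

Definition exec (w : nat) (i : instr) (st : state) : state :=
  let: State p R M := st in
  match i with
  | IConst r c => State p.+1 (upd R r (c %% 2 ^ w)) M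
  | IOp o r a b => State p.+1 (upd R r (eval_op w o (R a) (R b))) M
  | ILoad r a => State p.+1 (upd R r (M (R a))) M
  | IStore a r => State p.+1 R (upd M (R a) (R r))
  | IJz r l => State (if R r == 0 then l else p.+1) R M
  end.

Definition halted (P : seq instr) (st : state) : bool := size P <= pc st.

Definition step (w : nat) (P : seq instr) (st : state) : state :=
  if onth P (pc st) is Some i then exec w i st else st.

Definition run (w : nat) (P : seq instr) (t : nat) (st : state) : state :=
  iter t (step w P) st.

Definition accessed (P : seq instr) (st : state) : option nat :=
  match onth P (pc st) with
  | Some (ILoad _ a) => Some (regs st a)
  | Some (IStore a _) => Some (regs st a)
  | _ => None
  end.

(* P, started in st, halts within [time] steps in a state satisfying Q, and only
   ever accesses the memory cells 0, ..., space - 1. *)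
Definition runs_within (w : nat) (P : seq instr) (time space : nat)
    (st : state) (Q : state -> Prop) : Prop :=
  exists t : nat,
    [/\ t <= time,
        halted P (run w P t st),
        forall u a, u < t -> accessed P (run w P u st) = Some a -> a < space
      & Q (run w P t st)].

Section Encoding.
Variables (ds dp : Order.disp_t) (Ss : finOrderType ds) (Sp : finOrderType dp).

(* Each symbol takes two words, a tag and a value. An s-symbol or p-symbol is
   represented by its rank in its alphabet, an integer by itself. *)
Definition words (A : Type) (code : A -> nat) (X : seq (Ss + A)) : seq nat :=
  flatten [seq match x with
               | inl s => [:: 0; Order.enum_rank s : nat]
               | inr a => [:: 1; code a]
               end | x <- X].

Definition ewords (X : seq (ecode Ss)) : seq nat := words id X.

Definition pwords (X : seq (psym Ss Sp)) : seq nat :=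
  words (fun p : Sp => Order.enum_rank p : nat) X.

(* The length of the input is in register 0 and the input itself is in memory
   from address 0 on; everything else is 0. *)
Definition init (X : seq (ecode Ss)) : state :=
  State 0 (fun r => if r == 0 then size X else 0) (nth 0 (ewords X)).

(* The output is written from address 0 on. *)
Definition outputs (X : seq (psym Ss Sp)) (st : state) : Prop :=
  mkseq (memory st) (size (pwords X)) = pwords X.

End Encoding.

(* Main.v *)
Require Import Defs.
From HB Require Import structures.
From mathcomp Require Import all_boot all_order.
From mathcomp Require Import zify.

Set Implicit Arguments.
Unset Strict Implicit.
Unset Printing Implicit Defensive.

Import Order.TTheory.

(* Suppose that the first k columns of the sorted matrix of prev-encoded rotations
   are known. Prepending to row i the symbol described by L[i] gives the first
   k + 1 symbols of a prev-encoded rotation again: a p-symbol adds a leading 0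
   and replaces the L[i]-th 0 of the row, if that has been read, by its distance
   to the front. Every rotation is obtained in this way, so sorting the new rows
   gives the first k + 1 columns. After n rounds the row with L[i] = $ is the
   prev-encoding of T, from which a p-matching string is read off.

   A round takes quadratic time, as the lengths of the longest common prefixes of
   all pairs of rows are maintained: prepending changes each row in one place
   only, so that the new order and the new common prefix of two rows follow in
   constant time from the old ones and the two places.

   The machine program is compiled from a language of bounded loops over arrays,
   in which the running time is read off the nesting of the loops and the
   correctness is proved by weakest preconditions. *)

(** * A language of bounded loops over arrays *)

Inductive arith := AAdd | ASub | AMul | ALt | AEq.

Definition arith_eval (o : arith) (x y : nat) : nat :=
  match o with
  | AAdd => x + y | ASub => x - y | AMul => x * y | ALt => x < y | AEq => x == y
  end.

(* Variables are de Bruijn levels: the environment is a list to which [ESum] and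
   [SFor] append their index. *)
Inductive expr :=
  | EVar of nat
  | ECst of nat
  | EBin of arith & expr & expr
  | ECell of nat & expr & expr
  | EIf of expr & expr & expr
  | ESum of expr & expr.

Inductive stmt :=
  | SStore of nat & expr & expr & expr
  | SSeq of stmt & stmt
  | SFor of expr & stmt.

Definition store := nat -> nat -> nat -> nat.

Definition set_cell (A : store) (f i j v : nat) : store :=
  fun f' i' j' => if [&& f' == f, i' == i & j' == j] then v else A f' i' j'.

(* Field 0 is the input and output area, a vector of length 2n; the fields
   1, ..., K are n-by-n arrays. *)
Definition cell_valid (K n f i j : nat) : bool :=
  if f is f'.+1 then [&& f' < K, i < n & j < n] else (i < 2 * n) && (j == 0).

Section Logic.
Variables (K n B : nat).

Definition arith_ok (o : arith) (x y : nat) : bool :=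
  if o is ASub then y <= x else arith_eval o x y < B.

(* A value is only assigned to e if its evaluation neither overflows B nor
   accesses an invalid cell. *)
Fixpoint evals (rho : seq nat) (A : store) (e : expr) (v : nat) : Prop :=
  match e with
  | EVar x => x < size rho /\ v = nth 0 rho x
  | ECst c => c < B /\ v = c
  | EBin o e1 e2 => exists x y,
      [/\ evals rho A e1 x, evals rho A e2 y, arith_ok o x y
        & v = arith_eval o x y]
  | ECell f e1 e2 => exists i j,
      [/\ evals rho A e1 i, evals rho A e2 j, cell_valid K n f i j
        & v = A f i j]
  | EIf e1 e2 e3 => exists2 x, evals rho A e1 x
      & if x == 0 then evals rho A e3 v else evals rho A e2 v
  | ESum e1 e2 => exists m F,
      [/\ evals rho A e1 m, m <= n,
          forall i, i < m -> evals (rcons rho i) A e2 (F i),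
          \sum_(i < m) F i < B & v = \sum_(i < m) F i]
  end.

(* A loop is specified by an invariant, so that statements need no denotation. *)
Fixpoint wp (rho : seq nat) (s : stmt) (Q : store -> Prop) (A : store) : Prop :=
  match s with
  | SStore f e1 e2 e3 => exists i j v,
      [/\ evals rho A e1 i, evals rho A e2 j, evals rho A e3 v,
          cell_valid K n f i j & Q (set_cell A f i j v)]
  | SSeq s1 s2 => wp rho s1 (wp rho s2 Q) A
  | SFor e s1 => exists m (Inv : nat -> store -> Prop),
      [/\ evals rho A e m, m <= n, Inv 0 A,
          forall i A', i < m -> Inv i A' -> wp (rcons rho i) s1 (Inv i.+1) A'
        & forall A', Inv m A' -> Q A']
  end.

End Logic.

(** * Compilation to the word RAM *)

(* A block of code is a function of the address at which it is placed, since
   jumps are absolute. *)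
Definition code : Type := nat -> seq instr.

Definition line (l : seq instr) : code := fun _ => l.

Definition seqc (c1 c2 : code) : code :=
  fun off => let l := c1 off in l ++ c2 (off + size l).

Notation "c1 ;; c2" := (seqc c1 c2) (at level 60, right associativity).

Definition jump (s l : nat) : seq instr := [:: IConst s 0; IJz s l].

Definition branch (r s : nat) (c1 c0 : code) : code := fun off =>
  let l1 := c1 off.+1 in
  let off0 := off + size l1 + 3 in
  let l0 := c0 off0 in
  IJz r off0 :: l1 ++ jump s (off0 + size l0) ++ l0.

(* The index is in register t, the bound in register b; register t + 1 is used. *)
Definition loop (b t : nat) (body : code) : code := fun off =>
  let l := body (off + 3) in
  [:: IConst t 0; IOp OLt t.+1 t b; IJz t.+1 (off + 7 + size l)] ++ l ++
  [:: IConst t.+1 1; IOp OAdd t t t.+1] ++ jump t.+1 off.+1.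

Definition arith_op (o : arith) : binop :=
  match o with
  | AAdd => OAdd | ASub => OSub | AMul => OMul | ALt => OLt | AEq => OEq
  end.

(* The arrays are stored interleaved, above the 2n cells of field 0. *)
Definition addr (K n f i j : nat) : nat :=
  if f is f'.+1 then 2 * n + ((i * n + j) * K + f') else i.

Definition addr_code (K t f : nat) : seq instr :=
  if f is f'.+1 then
    [:: IOp OMul t t 0; IOp OAdd t t t.+1;
        IConst t.+1 K; IOp OMul t t t.+1;
        IConst t.+1 f'; IOp OAdd t t t.+1;
        IOp OAdd t t 0; IOp OAdd t t 0]
  else [::].

(* [env] lists the registers of the variables, register 0 holds n, and t is the
   first free register, which receives the value. *)
Fixpoint expr_code (K : nat) (env : seq nat) (t : nat) (e : expr) : code :=
  match e with
  | EVar x => line [:: IConst t 0; IOp OAdd t (nth 0 env x) t]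
  | ECst c => line [:: IConst t c]
  | EBin o e1 e2 =>
    expr_code K env t e1 ;; expr_code K env t.+1 e2 ;;
    line [:: IOp (arith_op o) t t t.+1]
  | ECell f e1 e2 =>
    expr_code K env t e1 ;; expr_code K env t.+1 e2 ;;
    line (addr_code K t f) ;; line [:: ILoad t t]
  | EIf e1 e2 e3 =>
    expr_code K env t e1 ;;
    branch t t.+1 (expr_code K env t e2) (expr_code K env t e3)
  | ESum e1 e2 =>
    expr_code K env t e1 ;;
    line [:: IConst t.+1 0] ;;
    loop t t.+2 (expr_code K (rcons env t.+2) t.+3 e2 ;;
                 line [:: IOp OAdd t.+1 t.+1 t.+3]) ;;
    line [:: IConst t.+2 0; IOp OAdd t t.+1 t.+2]
  end.

Fixpoint stmt_code (K : nat) (env : seq nat) (t : nat) (s : stmt) : code :=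
  match s with
  | SStore f e1 e2 e3 =>
    expr_code K env t e3 ;; expr_code K env t.+1 e1 ;;
    expr_code K env t.+2 e2 ;;
    line (addr_code K t.+1 f) ;; line [:: IStore t.+1 t]
  | SSeq s1 s2 => stmt_code K env t s1 ;; stmt_code K env t s2
  | SFor e s1 =>
    expr_code K env t e ;; loop t t.+1 (stmt_code K (rcons env t.+1) t.+2 s1)
  end.

(* A program for inputs of length n, which is given in register 0. *)
Definition compile (K : nat) (s : stmt) : seq instr := stmt_code K [:: 0] 1 s 0.

Fixpoint expr_time (n : nat) (e : expr) : nat :=
  match e with
  | EVar _ => 2
  | ECst _ => 1
  | EBin _ e1 e2 => expr_time n e1 + (expr_time n e2 + 1)
  | ECell _ e1 e2 => expr_time n e1 + (expr_time n e2 + (8 + 1))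
  | EIf e1 e2 e3 => expr_time n e1 + (expr_time n e2 + expr_time n e3 + 3)
  | ESum e1 e2 =>
    expr_time n e1 + (1 + (n * (expr_time n e2 + 1 + 6) + 3 + 2))
  end.

Fixpoint stmt_time (n : nat) (s : stmt) : nat :=
  match s with
  | SStore _ e1 e2 e3 =>
    expr_time n e3 + (expr_time n e1 + (expr_time n e2 + (8 + 1)))
  | SSeq s1 s2 => stmt_time n s1 + stmt_time n s2
  | SFor e s1 => expr_time n e + (n * (stmt_time n s1 + 6) + 3)
  end.

Fixpoint expr_deg (e : expr) : nat :=
  match e with
  | EVar _ | ECst _ => 0
  | EBin _ e1 e2 | ECell _ e1 e2 => maxn (expr_deg e1) (expr_deg e2)
  | EIf e1 e2 e3 => maxn (expr_deg e1) (maxn (expr_deg e2) (expr_deg e3))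
  | ESum e1 e2 => maxn (expr_deg e1) (expr_deg e2).+1
  end.

Fixpoint stmt_deg (s : stmt) : nat :=
  match s with
  | SStore _ e1 e2 e3 => maxn (expr_deg e1) (maxn (expr_deg e2) (expr_deg e3))
  | SSeq s1 s2 => maxn (stmt_deg s1) (stmt_deg s2)
  | SFor e s1 => maxn (expr_deg e) (stmt_deg s1).+1
  end.

Section TimeBound.
Variable n : nat.
Hypothesis n_gt0 : 0 < n.

Lemma leq_polyW a d x e : d <= e -> x <= a * n ^ d -> x <= a * n ^ e.
Proof.
by move=> de x_le; apply: leq_trans x_le _; rewrite leq_mul2l leq_pexp2l ?orbT.
Qed.

Lemma leq_polyD d x y a b :
  x <= a * n ^ d -> y <= b * n ^ d -> x + y <= (a + b) * n ^ d.
Proof. by move=> x_le y_le; rewrite mulnDl leq_add. Qed.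

Lemma leq_polyC d c : c <= c * n ^ d.
Proof. by rewrite leq_pmulr // expn_gt0 n_gt0. Qed.

Lemma leq_polyM d x a e : d < e -> x <= a * n ^ d -> n * x <= a * n ^ e.
Proof.
move=> de x_le; apply: leq_polyW de _.
by rewrite expnS mulnCA leq_mul2l x_le orbT.
Qed.

Lemma leq_expr_time e : expr_time n e <= expr_time 1 e * n ^ expr_deg e.
Proof.
elim: e =>
  [x|c|o e1 IH1 e2 IH2|f e1 IH1 e2 IH2|e1 IH1 e2 IH2 e3 IH3|e1 IH1 e2 IH2];
  rewrite [expr_time _ _]/= [expr_time 1 _]/= [expr_deg _]/= ?muln1 //;
  do !apply: leq_polyD; rewrite ?leq_polyC //;
  try (apply: leq_polyW; last eassumption; lia).
rewrite mul1n; apply: (@leq_polyM (expr_deg e2)); first by rewrite leq_max leqnn orbT.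
by do 2![apply: leq_polyD; last exact: leq_polyC].
Qed.

Lemma leq_stmt_time s : stmt_time n s <= stmt_time 1 s * n ^ stmt_deg s.
Proof.
elim: s => [f e1 e2 e3|s1 IH1 s2 IH2|e s IH];
  rewrite [stmt_time _ _]/= [stmt_time 1 _]/= [stmt_deg _]/=;
  do !apply: leq_polyD; rewrite ?leq_polyC //;
  try (apply: leq_polyW; last by [eassumption|exact: leq_expr_time]; lia).
rewrite mul1n; apply: (@leq_polyM (stmt_deg s)); first by rewrite leq_max leqnn orbT.
by apply: leq_polyD; last exact: leq_polyC.
Qed.

End TimeBound.

Definition code_at (P : seq instr) (off : nat) (l : seq instr) : Prop :=
  forall k, k < size l -> onth P (off + k) = onth l k.

Lemma code_at_cat P off l1 l2 :
  code_at P off (l1 ++ l2) ->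
  code_at P off l1 /\ code_at P (off + size l1) l2.
Proof.
move=> at_l; split=> k k_lt.
  by rewrite at_l ?onth_cat ?k_lt // size_cat ltn_addr.
rewrite -addnA at_l ?onth_cat ?size_cat ?ltn_add2l //.
by rewrite ltnNge leq_addr addKn.
Qed.

Lemma code_at_cons P off i l :
  code_at P off (i :: l) -> onth P off = Some i /\ code_at P off.+1 l.
Proof.
move=> at_l; split; first by rewrite -(addn0 off) at_l.
by move=> k k_lt; rewrite addSnnS at_l.
Qed.

Section Execution.
Variables (w sp : nat) (P : seq instr).

Definition reach (st : state) (t : nat) (st' : state) : Prop :=
  run w P t st = st' /\
  forall u a, u < t -> accessed P (run w P u st) = Some a -> a < sp.

Lemma reach_trans st1 st2 st3 t1 t2 :
  reach st1 t1 st2 -> reach st2 t2 st3 -> reach st1 (t1 + t2) st3.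
Proof.
move=> [<- low1] [<- low2]; split; first by rewrite addnC /run iterD.
move=> u a u_lt; case: (ltnP u t1) => [/low1|t1u]; first exact.
have -> : u = (u - t1) + t1 by lia.
by rewrite /run iterD => /low2; apply; lia.
Qed.

Definition computes (off off' T : nat) (R M : nat -> nat)
    (Q : (nat -> nat) -> (nat -> nat) -> Prop) : Prop :=
  exists t R' M',
    [/\ t <= T, reach (State off R M) t (State off' R' M') & Q R' M'].

Lemma computes_nil off R M (Q : _ -> _ -> Prop) :
  Q R M -> computes off off 0 R M Q.
Proof. by move=> q; exists 0, R, M; split. Qed.

Lemma computes_trans off1 off2 off3 T1 T2 R M Q1 Q2 :
  computes off1 off2 T1 R M Q1 ->
  (forall R1 M1, Q1 R1 M1 -> computes off2 off3 T2 R1 M1 Q2) ->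
  computes off1 off3 (T1 + T2) R M Q2.
Proof.
move=> [t [R1 [M1 [t_le run1 q1]]]] /(_ _ _ q1) [t' [R2 [M2 [t'_le run2 q2]]]].
by exists (t + t'), R2, M2; split=> //; [exact: leq_add|exact: reach_trans run1 run2].
Qed.

Lemma computes_weaken off off' T T' R M (Q Q' : _ -> _ -> Prop) :
  computes off off' T R M Q -> T <= T' -> (forall R M, Q R M -> Q' R M) ->
  computes off off' T' R M Q'.
Proof.
move=> [t [R1 [M1 [t_le run1 q]]]] TT' QQ'.
by exists t, R1, M1; split; [exact: leq_trans TT'|exact: run1|exact: QQ'].
Qed.

Lemma computes_step off i off' R M R' M' (Q : _ -> _ -> Prop) :
  onth P off = Some i -> exec w i (State off R M) = State off' R' M' ->
  (forall a, accessed P (State off R M) = Some a -> a < sp) ->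
  Q R' M' -> computes off off' 1 R M Q.
Proof.
move=> Pi exec_i acc q; exists 1, R', M'; split=> //; split.
  by rewrite /run /= /step /= Pi.
by case=> // a _ /acc.
Qed.

Definition straight (i : instr) : bool :=
  match i with IConst _ _ | IOp _ _ _ _ => true | _ => false end.

Definition exec_regs (R : nat -> nat) (i : instr) : nat -> nat :=
  regs (exec w i (State 0 R (fun _ => 0))).

Lemma computes_line off l R M (Q : _ -> _ -> Prop) :
  all straight l -> code_at P off l -> Q (foldl exec_regs R l) M ->
  computes off (off + size l) (size l) R M Q.
Proof.
elim: l off R => [|i l IH] off R /=.
  by move=> _ _ q; rewrite addn0; apply: computes_nil.
move=> /andP[i_straight l_straight] /code_at_cons[P_i at_l] q.
rewrite addnS -addSn -[(size l).+1]add1n.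
apply: (@computes_trans _ off.+1 _ _ _ _ _
          (fun R' M' => R' = exec_regs R i /\ M' = M)); last first.
  by move=> R1 M1 [-> ->]; apply: IH.
apply: (computes_step (R' := exec_regs R i) (M' := M) P_i) => // [|a].
  by case: i i_straight {P_i q}.
by rewrite /accessed /= P_i; case: i i_straight {P_i q}.
Qed.

Lemma computes_jz off r l R M (Q : _ -> _ -> Prop) :
  onth P off = Some (IJz r l) -> Q R M ->
  computes off (if R r == 0 then l else off.+1) 1 R M Q.
Proof.
by move=> P_jz; apply: (computes_step P_jz) => // a; rewrite /accessed /= P_jz.
Qed.

Lemma computes_jump off s l R M (Q : _ -> _ -> Prop) :
  code_at P off (jump s l) -> Q (upd R s 0) M -> computes off l 2 R M Q.
Proof.
move=> /(@code_at_cat _ _ [:: _])[at_cst /code_at_cons[P_jz _]] q; rewrite -[2]/(1 + 1).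
apply: (computes_trans (Q1 := fun R1 M1 => R1 = upd R s 0 /\ M1 = M)).
  by apply: computes_line at_cst _; rewrite //= /exec_regs /= mod0n.
move=> _ _ [-> ->]; have := computes_jz P_jz q.
by rewrite /upd !eqxx.
Qed.

Definition executes (c : code) (T : nat) (R M : nat -> nat)
    (Q : (nat -> nat) -> (nat -> nat) -> Prop) : Prop :=
  forall off, code_at P off (c off) ->
    computes off (off + size (c off)) T R M Q.

Lemma executes_weaken c T T' R M (Q Q' : _ -> _ -> Prop) :
  executes c T R M Q -> T <= T' -> (forall R M, Q R M -> Q' R M) ->
  executes c T' R M Q'.
Proof. by move=> c_ok TT' QQ' off /c_ok/computes_weaken; apply. Qed.

Lemma executes_line l R M (Q : _ -> _ -> Prop) :
  all straight l -> Q (foldl exec_regs R l) M ->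
  executes (line l) (size l) R M Q.
Proof. by move=> l_straight q off at_l; apply: computes_line. Qed.

Lemma executes_load t R M (Q : _ -> _ -> Prop) :
  R t < sp -> Q (upd R t (M (R t))) M ->
  executes (line [:: ILoad t t]) 1 R M Q.
Proof.
move=> t_lt q off /code_at_cons[P_i _]; rewrite addn1.
by apply: (computes_step P_i) => // a; rewrite /accessed /= P_i => -[<-].
Qed.

Lemma executes_store a r R M (Q : _ -> _ -> Prop) :
  R a < sp -> Q R (upd M (R a) (R r)) ->
  executes (line [:: IStore a r]) 1 R M Q.
Proof.
move=> a_lt q off /code_at_cons[P_i _]; rewrite addn1.
by apply: (computes_step P_i) => // b; rewrite /accessed /= P_i => -[<-].
Qed.

Lemma executes_seqc c1 c2 T1 T2 R M Q1 Q2 :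
  executes c1 T1 R M Q1 ->
  (forall R1 M1, Q1 R1 M1 -> executes c2 T2 R1 M1 Q2) ->
  executes (c1 ;; c2) (T1 + T2) R M Q2.
Proof.
move=> c1_ok c2_ok off /code_at_cat[/c1_ok run1 at_c2]; rewrite size_cat addnA.
by apply: (computes_trans run1) => R1 M1 /c2_ok; apply.
Qed.

Lemma executes_branch r s c1 c0 T1 T0 R M (Q : _ -> _ -> Prop) :
  (R r != 0 -> executes c1 T1 R M (fun R' M' => Q (upd R' s 0) M')) ->
  (R r = 0 -> executes c0 T0 R M Q) ->
  executes (branch r s c1 c0) (T1 + T0 + 3) R M Q.
Proof.
move=> c1_ok c0_ok off; rewrite /branch; set l1 := c1 _; set off0 := off + _ + 3.
move=> /code_at_cons[P_jz /code_at_cat[at_l1 /code_at_cat[at_jump at_l0]]].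
have -> : off + size (IJz r off0 :: l1 ++ jump s (off0 + size (c0 off0)) ++ c0 off0) =
    off0 + size (c0 off0) by rewrite /off0 /= !size_cat /=; lia.
have -> : T1 + T0 + 3 = 1 + (T1 + T0 + 2) by lia.
apply: (computes_trans (Q1 := fun R1 M1 => R1 = R /\ M1 = M)).
  exact: computes_jz P_jz _.
move=> _ _ [-> ->]; case: eqP => [/c0_ok{}c0_ok|/eqP/c1_ok{}c1_ok].
  apply: computes_weaken (c0_ok off0 _) _ _ => //; last by lia.
  by move: at_l0; rewrite (_ : off.+1 + _ + _ = off0) // /off0 /=; lia.
apply: (@computes_weaken _ _ (T1 + 2) _ _ _ Q) => //; last by lia.
by apply: (computes_trans (c1_ok _ at_l1)) => R' M'; apply: computes_jump.
Qed.

Definition agree_below (t : nat) (R R' : nat -> nat) : Prop :=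
  forall r, r < t -> R' r = R r.

Lemma agree_below_trans t t' R1 R2 R3 :
  t <= t' -> agree_below t R1 R2 -> agree_below t' R2 R3 -> agree_below t R1 R3.
Proof. by move=> tt' ag1 ag2 r r_lt; rewrite ag2 ?ag1 //; apply: leq_trans tt'. Qed.

Lemma agree_below_upd t s x R R' :
  t <= s -> agree_below t R R' -> agree_below t R (upd R' s x).
Proof. by move=> ts ag r r_lt; rewrite /upd ltn_eqF ?ag //; apply: leq_trans ts. Qed.

Section Loop.
Variables (b t : nat) (body : code) (m T : nat).
Variable Inv : nat -> (nat -> nat) -> (nat -> nat) -> Prop.
Hypotheses (B_gt1 : 1 < 2 ^ w) (m_lt : m < 2 ^ w).
Hypothesis Inv_bound : forall i R M, Inv i R M -> R b = m.
Hypothesis Inv_agree :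
  forall i R R' M, Inv i R M -> agree_below t R R' -> Inv i R' M.

Definition at_index (i : nat) (R M : nat -> nat) : Prop := Inv i R M /\ R t = i.

Hypothesis body_ok : forall i R M, i < m -> at_index i R M ->
  executes body T R M (fun R' M' => Inv i.+1 R' M' /\ R' t = i).

Lemma at_index_upd i R M s x : t < s -> at_index i R M -> at_index i (upd R s x) M.
Proof.
move=> ts [inv ti]; split; last by rewrite /upd ltn_eqF.
by apply: Inv_agree inv _; apply: agree_below_upd (ltnW ts) _.
Qed.

Lemma computes_guard off l i R M :
  code_at P off [:: IOp OLt t.+1 t b; IJz t.+1 l] -> at_index i R M ->
  computes off (if i < m then off.+2 else l) 2 R M (at_index i).
Proof.
move=> /(@code_at_cat _ _ [:: _])[at_cmp /code_at_cons[P_jz _]] iR.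
rewrite -[2]/(1 + 1).
have lt_mod : (i < m) %% 2 ^ w = (i < m).
  by rewrite modn_small //; apply: leq_ltn_trans B_gt1; case: ltnP.
apply: (computes_trans (Q1 := fun R1 M1 => R1 = upd R t.+1 (i < m) /\ M1 = M)).
  case: iR => inv ti; apply: computes_line at_cmp _; rewrite //= /exec_regs /=.
  by rewrite /eval_op ti (Inv_bound inv) lt_mod.
move=> _ _ [-> ->]; have := computes_jz P_jz (at_index_upd (i < m) (ltnSn t) iR).
by rewrite {1}/upd eqxx addn1; case: ltnP.
Qed.

Lemma computes_increment off i R M :
  code_at P off [:: IConst t.+1 1; IOp OAdd t t t.+1] -> i < m ->
  Inv i.+1 R M -> R t = i -> computes off (off + 2) 2 R M (at_index i.+1).
Proof.
move=> at_inc im inv ti; apply: computes_line at_inc _ => //=.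
rewrite /exec_regs /= /eval_op !(modn_small B_gt1) [upd _ _ _ t]/upd.
rewrite [upd _ _ _ t.+1]/upd eqxx ltn_eqF // addn1 ti modn_small.
  by split; [apply: Inv_agree inv _; do 2?apply: agree_below_upd|rewrite /upd eqxx].
exact: leq_ltn_trans m_lt.
Qed.

Lemma computes_iterations off exit d i R M :
  let l := body (off + 2) in
  code_at P off ([:: IOp OLt t.+1 t b; IJz t.+1 exit] ++ l ++
                 [:: IConst t.+1 1; IOp OAdd t t t.+1] ++ jump t.+1 off) ->
  i + d = m -> at_index i R M ->
  computes off exit (d * (T + 6) + 2) R M (Inv m).
Proof.
move=> l /code_at_cat[at_guard]; rewrite [size _]/= => /code_at_cat[at_body].
move=> /code_at_cat[at_inc at_jump]; elim: d i R M => [|d IHd] i R M idm iR.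
  have := computes_guard at_guard iR; rewrite -[X in i < X]idm addn0 ltnn => guard.
  by apply: (computes_weaken guard) => // R' M' []; rewrite -idm addn0.
have im : i < m by lia.
rewrite (_ : _ + 2 = 2 + (T + (2 + (2 + (d * (T + 6) + 2))))); last by lia.
apply: (@computes_trans _ (off + 2) _ _ _ _ _ (at_index i)).
  by have := computes_guard at_guard iR; rewrite im addn2.
move=> R1 M1 iR1; apply: (computes_trans (body_ok im iR1 at_body)) => R2 M2 [inv2 ti2].
apply: (computes_trans (computes_increment at_inc im inv2 ti2)) => R3 M3 iR3.
apply: (computes_trans (Q1 := at_index i.+1)) => [|R4 M4].
  by apply: computes_jump at_jump _; apply: at_index_upd.
by apply: IHd; lia.
Qed.

Lemma executes_loop n R M :
  m <= n -> Inv 0 R M ->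
  executes (loop b t body) (n * (T + 6) + 3) R M (Inv m).
Proof.
move=> mn inv0 off; rewrite /loop; set l := body _.
set exit := off + 7 + size l => at_loop.
rewrite [off + size _](_ : _ = exit); last by rewrite /exit !size_cat /=; lia.
have [at_init] := @code_at_cat _ _ [:: _] _ at_loop.
rewrite [size _]/= addn1 => at_rest.
apply: (@computes_weaken _ _ (1 + (m * (T + 6) + 2)) _ _ _ (Inv m)) => //; last first.
  by rewrite addnCA leq_add2r leq_mul2r mn orbT.
apply: (@computes_trans _ off.+1 _ _ _ _ _ (at_index 0)) => [|R1 M1].
  rewrite -addn1; apply: computes_line at_init _ => //=; rewrite /exec_regs /= mod0n.
  by split; [apply: Inv_agree inv0 _; apply: agree_below_upd|rewrite /upd eqxx].
by apply: computes_iterations; rewrite // addSnnS.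
Qed.

End Loop.
End Execution.

Lemma mixed_radix_inj d x y x' y' :
  y < d -> y' < d -> x * d + y = x' * d + y' -> x = x' /\ y = y'.
Proof.
move=> yd yd' e; have d0 : 0 < d by apply: leq_ltn_trans yd.
have eq_x : x = x'.
  by move/(congr1 (divn^~ d)): e; rewrite !divnMDl // !divn_small // !addn0.
by split=> //; move: e; rewrite eq_x => /addnI.
Qed.

Lemma ltn_mixed_radix a d x y : x < a -> y < d -> x * d + y < a * d.
Proof.
move=> xa yd; apply: (@leq_trans (x.+1 * d)); last by rewrite leq_mul2r xa orbT.
by rewrite mulSn addnC ltn_add2r.
Qed.

Section Addresses.
Variables (K n : nat).

Lemma addr_lt f i j :
  cell_valid K n f i j -> addr K n f i j < 2 * n + n * n * K.
Proof.
case: f => [|f] /=; first by case/andP=> i_lt _; apply: ltn_addr.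
by case/and3P=> fK il jl; rewrite ltn_add2l; do 2?apply: ltn_mixed_radix.
Qed.

Lemma addr_inj f i j f' i' j' :
  cell_valid K n f i j -> cell_valid K n f' i' j' ->
  addr K n f i j = addr K n f' i' j' -> [/\ f = f', i = i' & j = j'].
Proof.
case: f f' => [|f] [|f'] /=.
- by case/andP=> _ /eqP-> /andP[_ /eqP->].
- by move=> /andP[i_lt _] /and3P[]; lia.
- by move=> /and3P[_ _ _] /andP[]; lia.
move=> /and3P[fK il jl] /and3P[fK' il' jl'] /addnI.
by case/(mixed_radix_inj fK fK') => /(mixed_radix_inj jl jl')[-> ->] ->.
Qed.

End Addresses.

Section CompilerCorrectness.
Variables (w sp : nat) (P : seq instr) (K n : nat).
Notation B := (2 ^ w).
Hypotheses (B_gt1 : 1 < B) (n_lt : n < B) (K_lt : K < B).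
Hypotheses (sp_le : sp <= B) (cells_le : 2 * n + n * n * K <= sp).

Notation evals := (evals K n B).
Notation wp := (wp K n B).
Notation executes := (executes w sp P).

Definition store_rel (A : store) (M : nat -> nat) : Prop :=
  forall f i j, cell_valid K n f i j ->
    M (addr K n f i j) = A f i j /\ A f i j < B.

Definition env_rel (rho env : seq nat) (t : nat) (R : nat -> nat) : Prop :=
  [/\ rho = map R env, all (ltn^~ t) env, all (ltn^~ B) rho, 0 < t & R 0 = n].

Definition delivers (t x : nat) (R M R' M' : nat -> nat) : Prop :=
  [/\ M' = M, agree_below t R R' & R' t = x].

Lemma env_rel_agree rho env t R R' :
  env_rel rho env t R -> agree_below t R R' -> env_rel rho env t R'.
Proof.
move=> [-> env_lt rho_lt t0 R0] ag; split=> //; last by rewrite ag.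
by apply/esym/eq_in_map => r /(allP env_lt) /ag.
Qed.

Lemma env_rel_widen rho env t t' R :
  t <= t' -> env_rel rho env t R -> env_rel rho env t' R.
Proof.
move=> tt' [e env_lt rho_lt t0 R0]; split=> //; last exact: leq_trans tt'.
by apply: sub_all env_lt => r rt; apply: leq_trans tt'.
Qed.

Lemma env_rel_rcons rho env t R i :
  env_rel rho env t R -> i < B -> R t = i ->
  env_rel (rcons rho i) (rcons env t) t.+1 R.
Proof.
move=> [-> env_lt rho_lt _ R0] iB ti; split; rewrite ?map_rcons ?all_rcons ?ti //.
  by rewrite /= ltnSn; apply: sub_all env_lt => r; apply: ltnW.
by rewrite /= iB.
Qed.

Lemma eval_op_arith o x y :
  x < B -> y < B -> arith_ok B o x y ->
  eval_op w (arith_op o) x y = arith_eval o x y.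
Proof.
case: o => /= xB yB ok; rewrite /eval_op ?(modn_small ok) //.
rewrite addnBCA ?(ltnW yB) // modnDl modn_small //.
exact: leq_ltn_trans (leq_subr _ _) xB.
Qed.

Lemma evals_lt A M rho e v :
  store_rel A M -> all (ltn^~ B) rho -> evals rho A e v -> v < B.
Proof.
move=> store_A rho_lt; elim: e v =>
  [x|c|o e1 IH1 e2 IH2|f e1 IH1 e2 IH2|e1 _ e2 IH2 e3 IH3|e1 IH1 e2 IH2] v /=.
- by case=> x_lt ->; apply: (all_nthP 0 rho_lt).
- by case=> c_lt ->.
- move=> [x [y [/IH1 xB _ ok ->]]]; case: o ok => //= _.
  exact: leq_ltn_trans (leq_subr _ _) xB.
- by move=> [i [j [_ _ /store_A[_ Af] ->]]].
- by case=> x _; case: ifP => _; [apply: IH3|apply: IH2].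
- by case=> m [F [_ _ _ sB ->]].
Qed.

Lemma executes_addr_code f i j t R M :
  0 < t -> R 0 = n -> R t = i -> R t.+1 = j -> cell_valid K n f i j ->
  executes (line (addr_code K t f)) 8 R M (delivers t (addr K n f i j) R M).
Proof.
case: f => [|f] t0 R0 Ri Rj valid.
  apply: (@executes_weaken _ _ _ _ 0 _ _ _ (delivers t i R M)) => //.
  exact: executes_line.
apply: executes_line; rewrite [addr_code _ _ _]/=; first by [].
have aB : addr K n f.+1 i j < B by apply: leq_trans (addr_lt valid) _; lia.
case/and3P: valid => fK _ _; rewrite /= in aB.
have ijK : i * n + j <= (i * n + j) * K by rewrite leq_pmulr //; lia.
split=> //; first by do ?[apply: agree_below_upd].
rewrite [foldl _ _ _]/= /exec_regs /= /eval_op /upd !eqxx.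
rewrite (ltn_eqF t0) (ltn_eqF (ltn0Sn t)) (ltn_eqF (ltnSn t)) (gtn_eqF (ltnSn t)).
rewrite R0 Ri Rj.
rewrite (@modn_small (i * n)) 1?(@modn_small K) 1?(@modn_small f); try lia.
rewrite (@modn_small (i * n + j)) 1?(@modn_small ((i * n + j) * K)); try lia.
rewrite (@modn_small (_ + f)) 1?(@modn_small (_ + f + n)) ?modn_small; lia.
Qed.

Definition expr_correct (e : expr) : Prop := forall rho env t A R M x,
  store_rel A M -> env_rel rho env t R -> evals rho A e x ->
  executes (expr_code K env t e) (expr_time n e) R M (delivers t x R M).

Lemma executes_operands e1 e2 rho env t A R M x y c T Q :
  expr_correct e1 -> expr_correct e2 ->
  store_rel A M -> env_rel rho env t R -> evals rho A e1 x -> evals rho A e2 y ->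
  (forall R', agree_below t R R' -> R' t = x -> R' t.+1 = y ->
     executes c T R' M Q) ->
  executes (expr_code K env t e1 ;; expr_code K env t.+1 e2 ;; c)
    (expr_time n e1 + (expr_time n e2 + T)) R M Q.
Proof.
move=> e1_ok e2_ok store_A env_R ev1 ev2 c_ok.
apply: (executes_seqc (e1_ok _ _ _ _ _ _ _ store_A env_R ev1)) => R1 M1 [-> ag1 r1].
have env_R1 := env_rel_widen (leqnSn t) (env_rel_agree env_R ag1).
apply: (executes_seqc (e2_ok _ _ _ _ _ _ _ store_A env_R1 ev2)) => R2 M2 [-> ag2 r2].
by apply: c_ok; [exact: agree_below_trans ag1 ag2|rewrite ag2|].
Qed.

Lemma executes_cell_addr e1 e2 rho env t A R M f i j c T Q :
  expr_correct e1 -> expr_correct e2 ->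
  store_rel A M -> env_rel rho env t R -> evals rho A e1 i -> evals rho A e2 j ->
  cell_valid K n f i j ->
  (forall R', agree_below t R R' -> R' t = addr K n f i j -> executes c T R' M Q) ->
  executes (expr_code K env t e1 ;; expr_code K env t.+1 e2 ;;
            line (addr_code K t f) ;; c)
    (expr_time n e1 + (expr_time n e2 + (8 + T))) R M Q.
Proof.
move=> e1_ok e2_ok store_A env_R ev1 ev2 valid c_ok.
apply: (executes_operands e1_ok e2_ok store_A env_R ev1 ev2) => R1 ag1 ri rj.
have [_ _ _ t0 R0] := env_rel_agree env_R ag1.
apply: (executes_seqc (executes_addr_code M t0 R0 ri rj valid)) => R2 M2 [-> ag2 ra].
by apply: c_ok => //; exact: agree_below_trans ag1 ag2.
Qed.

Lemma expr_correct_var x : expr_correct (EVar x).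
Proof.
move=> rho env t A R M v _ [-> env_lt rho_lt t0 R0]; rewrite /= size_map => -[x_lt ->].
apply: executes_line => //; rewrite /= /exec_regs /=.
split=> //; first by do ?[apply: agree_below_upd].
rewrite /upd !eqxx ltn_eqF; last exact: (all_nthP 0 env_lt).
rewrite mod0n /eval_op addn0 (nth_map 0) // modn_small //.
by have /(all_nthP 0)/(_ x) := rho_lt; rewrite size_map (nth_map 0) //; apply.
Qed.

Lemma expr_correct_cst c : expr_correct (ECst c).
Proof.
move=> rho env t A R M v _ _ [cB ->]; apply: executes_line => //=.
rewrite /exec_regs /=; split=> //; first exact: agree_below_upd.
by rewrite /upd eqxx modn_small.
Qed.

Lemma expr_correct_bin o e1 e2 :
  expr_correct e1 -> expr_correct e2 -> expr_correct (EBin o e1 e2).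
Proof.
move=> e1_ok e2_ok rho env t A R M v store_A env_R [x [y [ev1 ev2 ok ->]]].
apply: (executes_operands e1_ok e2_ok store_A env_R ev1 ev2) => R1 ag rx ry.
apply: executes_line => //; rewrite /= /exec_regs /= rx ry.
split=> //; first exact: agree_below_upd.
have [_ _ rho_lt _ _] := env_R; rewrite /upd eqxx eval_op_arith //.
  exact: evals_lt store_A rho_lt ev1.
exact: evals_lt store_A rho_lt ev2.
Qed.

Lemma expr_correct_cell f e1 e2 :
  expr_correct e1 -> expr_correct e2 -> expr_correct (ECell f e1 e2).
Proof.
move=> e1_ok e2_ok rho env t A R M v store_A env_R [i [j [ev1 ev2 valid ->]]].
apply: (executes_cell_addr e1_ok e2_ok store_A env_R ev1 ev2 valid) => R1 ag ra.
apply: executes_load; rewrite ra; first exact: leq_trans (addr_lt valid) _.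
by split=> //; [exact: agree_below_upd|rewrite /upd eqxx; case: (store_A _ _ _ valid)].
Qed.

Lemma expr_correct_if e1 e2 e3 :
  expr_correct e1 -> expr_correct e2 -> expr_correct e3 ->
  expr_correct (EIf e1 e2 e3).
Proof.
move=> e1_ok e2_ok e3_ok rho env t A R M v store_A env_R [x ev1 ev23].
apply: (executes_seqc (e1_ok _ _ _ _ _ _ _ store_A env_R ev1)) => R1 M1 [-> ag1 rx].
have env_R1 := env_rel_agree env_R ag1.
apply: executes_branch; rewrite rx => x0.
  rewrite (negPf x0) in ev23.
  apply: (executes_weaken (e2_ok _ _ _ _ _ _ _ store_A env_R1 ev23)) => //.
  move=> R2 M2 [-> ag2 rv].
  split=> //; first exact: agree_below_upd (leqnSn t) (agree_below_trans _ ag1 ag2).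
  by rewrite /upd ltn_eqF.
rewrite x0 eqxx in ev23.
apply: (executes_weaken (e3_ok _ _ _ _ _ _ _ store_A env_R1 ev23)) => //.
move=> R2 M2 [-> ag2 rv].
by split=> //; exact: agree_below_trans ag1 ag2.
Qed.

Lemma leq_sum_ord (F : nat -> nat) i m :
  i <= m -> \sum_(j < i) F j <= \sum_(j < m) F j.
Proof.
move=> im; rewrite -!(big_mkord xpredT F) [leqRHS](big_cat_nat (leq0n i) im).
exact: leq_addr.
Qed.

Definition summing (F : nat -> nat) (t m : nat) (R M : nat -> nat)
    (i : nat) (R' M' : nat -> nat) : Prop :=
  [/\ M' = M, agree_below t R R', R' t = m & R' t.+1 = \sum_(j < i) F j].

Lemma summing_agree F t m R M i R1 R2 M1 :
  summing F t m R M i R1 M1 -> agree_below t.+2 R1 R2 -> summing F t m R M i R2 M1.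
Proof.
move=> [-> ag1 rm rsum] ag2.
by split=> //; [apply: agree_below_trans ag1 ag2|rewrite ag2|rewrite ag2]; lia.
Qed.

Lemma executes_summand e rho env t A R M F m i R1 M1 :
  expr_correct e -> store_rel A M -> env_rel rho env t R ->
  evals (rcons rho i) A e (F i) -> i < B -> \sum_(j < i.+1) F j < B ->
  summing F t m R M i R1 M1 -> R1 t.+2 = i ->
  executes (expr_code K (rcons env t.+2) t.+3 e ;;
            line [:: IOp OAdd t.+1 t.+1 t.+3])
    (expr_time n e + 1) R1 M1
    (fun R' M' => summing F t m R M i.+1 R' M' /\ R' t.+2 = i).
Proof.
move=> e_ok store_A env_R ev iB sumB [-> ag1 rm rsum] ri.
have env_R1 : env_rel (rcons rho i) (rcons env t.+2) t.+3 R1.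
  apply: env_rel_rcons iB ri.
  by apply: env_rel_widen (env_rel_agree env_R ag1); lia.
apply: (executes_seqc (e_ok _ _ _ _ _ _ _ store_A env_R1 ev)) => R2 M2 [-> ag2 rF].
apply: executes_line => //=; rewrite /exec_regs /= rF.
rewrite ag2 // rsum /eval_op; split; last by rewrite /upd gtn_eqF // ag2.
rewrite big_ord_recr /= in sumB.
split=> //; last by rewrite /upd eqxx modn_small // big_ord_recr.
- by apply: agree_below_upd => //; apply: agree_below_trans ag1 ag2; lia.
- by rewrite /upd ltn_eqF // ag2 //; lia.
Qed.

Lemma expr_correct_sum e1 e2 :
  expr_correct e1 -> expr_correct e2 -> expr_correct (ESum e1 e2).
Proof.
move=> e1_ok e2_ok rho env t A R M v store_A env_R [m [F [ev1 mn ev2 sumB ->]]].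
have mB : m < B := leq_ltn_trans mn n_lt.
apply: (executes_seqc (e1_ok _ _ _ _ _ _ _ store_A env_R ev1)) => R1 M1 [-> ag1 rm].
apply: (executes_seqc (Q1 := summing F t m R M 0)).
  apply: executes_line => //=; rewrite /exec_regs /= mod0n.
  split=> //; first exact: agree_below_upd.
    by rewrite /upd ltn_eqF.
  by rewrite /upd eqxx big_ord0.
move=> R2 M2 sum0; apply: (executes_seqc (Q1 := summing F t m R M m)); last first.
  move=> R3 M3 [-> ag3 rm3 rsum]; apply: executes_line => //=.
  split=> //; rewrite /exec_regs /=; first by do ?[apply: agree_below_upd => //]; lia.
  by rewrite /upd !eqxx ltn_eqF // rsum mod0n /eval_op addn0 modn_small.
apply: (executes_loop (Inv := summing F t m R M) B_gt1 mB _ _ _ mn sum0).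
- by move=> i R3 M3 [].
- by move=> i R3 R4 M3; apply: summing_agree.
move=> i R3 M3 im [sumi ri].
apply: executes_summand store_A env_R (ev2 i im) _ _ sumi ri => //.
  exact: ltn_trans mB.
exact: leq_ltn_trans (leq_sum_ord F im) sumB.
Qed.

Lemma expr_code_correct e : expr_correct e.
Proof.
elim: e => [x|c|o e1 ? e2 ?|f e1 ? e2 ?|e1 ? e2 ? e3 ?|e1 ? e2 ?].
- exact: expr_correct_var.
- exact: expr_correct_cst.
- exact: expr_correct_bin.
- exact: expr_correct_cell.
- exact: expr_correct_if.
- exact: expr_correct_sum.
Qed.

Lemma store_rel_set A M f i j v :
  store_rel A M -> cell_valid K n f i j -> v < B ->
  store_rel (set_cell A f i j v) (upd M (addr K n f i j) v).
Proof.
move=> store_A valid vB f' i' j' valid'; rewrite /upd /set_cell.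
case: eqP => [/(addr_inj valid' valid)[-> -> ->]|ne]; first by rewrite !eqxx.
rewrite ifN; first exact: store_A.
by apply/negP => /and3P[/eqP ef /eqP ei /eqP ej]; apply: ne; rewrite ef ei ej.
Qed.

Definition stmt_correct (s : stmt) : Prop := forall rho env t Q A R M,
  store_rel A M -> env_rel rho env t R -> wp rho s Q A ->
  executes (stmt_code K env t s) (stmt_time n s) R M
    (fun R' M' => agree_below t R R' /\ exists2 A', Q A' & store_rel A' M').

Lemma stmt_correct_store f e1 e2 e3 : stmt_correct (SStore f e1 e2 e3).
Proof.
move=> rho env t Q A R M store_A env_R [i [j [v [ev1 ev2 ev3 valid q]]]].
apply: (executes_seqc (expr_code_correct store_A env_R ev3)) => R1 M1 [-> ag1 rv].
have env_R1 := env_rel_widen (leqnSn t) (env_rel_agree env_R ag1).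
apply: (executes_cell_addr (@expr_code_correct e1) (@expr_code_correct e2)
          store_A env_R1 ev1 ev2 valid) => R2 ag2 ra.
apply: executes_store; rewrite ra; first exact: leq_trans (addr_lt valid) _.
split; first exact: agree_below_trans ag1 ag2.
exists (set_cell A f i j v) => //; rewrite ag2 // rv; apply: store_rel_set => //.
by have [_ _ rho_lt _ _] := env_R; exact: evals_lt store_A rho_lt ev3.
Qed.

Lemma stmt_correct_seq s1 s2 :
  stmt_correct s1 -> stmt_correct s2 -> stmt_correct (SSeq s1 s2).
Proof.
move=> s1_ok s2_ok rho env t Q A R M store_A env_R wp1.
apply: (executes_seqc (s1_ok _ _ _ _ _ _ _ store_A env_R wp1)).
move=> R1 M1 [ag1 [A1 wp2 store_A1]].
have env_R1 := env_rel_agree env_R ag1.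
apply: (executes_weaken (s2_ok _ _ _ _ _ _ _ store_A1 env_R1 wp2)) => //.
move=> R2 M2 [ag2 store_A2].
by split=> //; exact: agree_below_trans ag1 ag2.
Qed.

Lemma stmt_correct_for e s : stmt_correct s -> stmt_correct (SFor e s).
Proof.
move=> s_ok rho env t Q A R M store_A env_R [m [Inv [ev mn inv0 invS invQ]]].
have mB : m < B := leq_ltn_trans mn n_lt.
apply: (executes_seqc (expr_code_correct store_A env_R ev)) => R1 M1 [-> ag1 rm].
pose InvR i R' M' :=
  [/\ agree_below t R R', R' t = m & exists2 A', Inv i A' & store_rel A' M'].
have invR0 : InvR 0 R1 M by split=> //; exists A.
apply: (executes_weaken (executes_loop (Inv := InvR) B_gt1 mB _ _ _ mn invR0)) => //.
- by move=> i R2 M2 [].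
- move=> i R2 R3 M2 [ag2 rm2 inv_A] ag3.
  by split=> //; [apply: agree_below_trans ag2 ag3|rewrite ag3].
- move=> i R2 M2 im [[ag2 rm2 [A2 inv2 store_A2]] ri].
  have env_R2 : env_rel (rcons rho i) (rcons env t.+1) t.+2 R2.
    apply: env_rel_rcons ri; last exact: ltn_trans mB.
    exact: env_rel_widen (env_rel_agree env_R ag2).
  have wp_s := invS i A2 im inv2.
  apply: (executes_weaken (s_ok _ _ _ _ _ _ _ store_A2 env_R2 wp_s)) => //.
  move=> R3 M3 [ag3 inv_A]; split; last by rewrite ag3.
  by split; [apply: agree_below_trans ag2 ag3; lia|rewrite ag3|].
by move=> R2 M2 [ag2 _ [A2 /invQ q store_A2]]; split=> //; exists A2.
Qed.

Lemma stmt_code_correct s : stmt_correct s.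
Proof.
elim: s => [f e1 e2 e3|s1 ? s2 ?|e s ?].
- exact: stmt_correct_store.
- exact: stmt_correct_seq.
- exact: stmt_correct_for.
Qed.

End CompilerCorrectness.

Theorem compile_correct w sp K n s Q A R M :
  1 < 2 ^ w -> n < 2 ^ w -> K < 2 ^ w -> sp <= 2 ^ w ->
  2 * n + n * n * K <= sp ->
  R 0 = n -> store_rel w K n A M -> wp K n (2 ^ w) [:: n] s Q A ->
  runs_within w (compile K s) (stmt_time n s) sp (State 0 R M)
    (fun st => exists2 A', Q A' & store_rel w K n A' (memory st)).
Proof.
move=> B_gt1 n_lt K_lt sp_le cells_le R0 store_A wp_s.
have env_R : env_rel w n [:: n] [:: 0] 1 R by split; rewrite //= ?R0 ?n_lt.
have [//|t [R' [M' [tT [rn acc] [_ q]]]]] := stmt_code_correct B_gt1 n_lt K_lt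
  sp_le cells_le store_A env_R wp_s (P := compile K s) (off := 0).
by exists t; split=> //; rewrite rn // /halted add0n.
Qed.

(** * Longest common prefixes and the lexicographic order *)

Definition prepend (T : Type) (x : T) (f : nat -> T) (q : nat) : T :=
  if q is q'.+1 then f q' else x.

Lemma mkseqSl (T : Type) (f : nat -> T) k :
  mkseq f k.+1 = f 0 :: mkseq (f \o succn) k.
Proof. by rewrite /mkseq /= (iotaDl 1 0) -map_comp. Qed.

Section Lcp.
Variable T : eqType.
Implicit Types f g : nat -> T.

Definition lcp f g k := find (fun q => f q != g q) (iota 0 k).

Lemma lcp_le f g k : lcp f g k <= k.
Proof. by rewrite -[leqRHS](size_iota 0) find_size. Qed.

Lemma eq_before_lcp f g k q : q < lcp f g k -> f q = g q.
Proof.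
move=> q_lt; have qk := leq_trans q_lt (lcp_le f g k).
by have /negbT := before_find 0 q_lt; rewrite nth_iota // negbK => /eqP.
Qed.

Lemma neq_at_lcp f g k : lcp f g k < k -> f (lcp f g k) <> g (lcp f g k).
Proof.
move=> lk; have differ : has (fun q => f q != g q) (iota 0 k).
  by rewrite has_find size_iota.
by have := nth_find 0 differ; rewrite nth_iota // => /eqP.
Qed.

Lemma lcp_neq f g k p :
  lcp f g k < k -> (p < k -> f p = g p) -> lcp f g k != p.
Proof.
by move=> lk eq_p; apply/eqP => lp; apply: (neq_at_lcp lk); rewrite lp eq_p // -lp.
Qed.

Lemma lcp_unique f g k l :
  l <= k -> (forall q, q < l -> f q = g q) -> (l < k -> f l <> g l) ->
  lcp f g k = l.
Proof.
move=> lk eq_l neq_l; case: (ltngtP (lcp f g k) l) => // l_lt.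
  by have := neq_at_lcp (leq_trans l_lt lk); rewrite eq_l.
by have := neq_l (leq_trans l_lt (lcp_le f g k)); rewrite (eq_before_lcp l_lt).
Qed.

Lemma lcpC f g k : lcp f g k = lcp g f k.
Proof.
apply: lcp_unique => [|q /eq_before_lcp //|/neq_at_lcp neq_l eq_l].
  exact: lcp_le.
exact: neq_l.
Qed.

Lemma eq_in_lcp f g f' g' k :
  (forall q, q < k -> f q = f' q) -> (forall q, q < k -> g q = g' q) ->
  lcp f g k = lcp f' g' k.
Proof.
move=> eq_f eq_g; apply: lcp_unique => [|q q_lt|l_lt]; first exact: lcp_le.
  have qk := leq_trans q_lt (lcp_le f' g' k).
  by rewrite eq_f // eq_g // (eq_before_lcp q_lt).
by rewrite eq_f // eq_g //; exact: neq_at_lcp.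
Qed.

Lemma lcpS f g k :
  lcp f g k.+1 = if f 0 == g 0 then (lcp (f \o succn) (g \o succn) k).+1 else 0.
Proof.
case: eqP => e; apply: lcp_unique => //; first by rewrite ltnS lcp_le.
  by case=> // q; rewrite ltnS => /eq_before_lcp.
by rewrite ltnS => /neq_at_lcp.
Qed.

Lemma lcp_prepend x y f g k :
  lcp (prepend x f) (prepend y g) k.+1 = if x == y then (lcp f g k).+1 else 0.
Proof. exact: lcpS. Qed.

Lemma lcp_eq_full f g k : (lcp f g k == k) = (mkseq f k == mkseq g k).
Proof.
elim: k f g => [|k IH] f g; first by rewrite -leqn0 lcp_le eqxx.
by rewrite lcpS !mkseqSl eqseq_cons -IH; case: (f 0 == g 0).
Qed.

End Lcp.

Section Lex.
Variables (ds : Order.disp_t) (Ss : finOrderType ds).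
Implicit Types (x y z : ecode Ss) (X Y Z : seq (ecode Ss)) (f g : nat -> ecode Ss).

Lemma ecode_ltxx x : ecode_lt x x = false.
Proof. by case: x => [s|k] /=; rewrite ?ltxx ?ltnn. Qed.

Lemma ecode_lt_trans x y z : ecode_lt x y -> ecode_lt y z -> ecode_lt x z.
Proof.
by case: x y z => [s|k] [s'|k'] [s''|k''] //=; [exact: lt_trans|exact: ltn_trans].
Qed.

Lemma ecode_lt_asym x y : ecode_lt x y -> ecode_lt y x = false.
Proof.
by move=> xy; apply/negP => /(ecode_lt_trans xy); rewrite ecode_ltxx.
Qed.

Lemma ecode_lt_total x y : [|| ecode_lt x y, x == y | ecode_lt y x].
Proof.
case: x y => [s|k] [s'|k'] //=.
  by rewrite (inj_eq (@inl_inj _ _)); case: ltgtP.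
by rewrite (inj_eq (@inr_inj _ _)); case: ltngtP.
Qed.

Lemma lex_le_refl : reflexive (@lex_le _ Ss).
Proof. by elim=> //= x X IH; rewrite eqxx IH orbT. Qed.

Lemma lex_le_trans : transitive (@lex_le _ Ss).
Proof.
elim=> [|y Y IH] [|x X] [|z Z] //=.
case/orP=> [xy|/andP[/eqP-> XY]] /orP[yz|/andP[/eqP<- YZ]].
- by rewrite (ecode_lt_trans xy yz).
- by rewrite xy.
- by rewrite yz.
- by rewrite eqxx (IH _ _ XY YZ) orbT.
Qed.

Lemma lex_le_anti : antisymmetric (@lex_le _ Ss).
Proof.
elim=> [|x X IH] [|y Y] //= /andP[].
case/orP=> [xy|/andP[/eqP-> XY]].
  rewrite (ecode_lt_asym xy) /=; case: eqP => //= e.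
  by rewrite e ecode_ltxx in xy.
by rewrite ecode_ltxx eqxx /= => YX; rewrite (IH Y) // XY YX.
Qed.

Lemma lex_le_total : total (@lex_le _ Ss).
Proof.
elim=> [|x X IH] [|y Y] //=.
have := ecode_lt_total x y; case: (ecode_lt x y) => //=.
case: eqP => [->|_] /=; last by move->.
by rewrite eqxx ecode_ltxx /=; case/orP: (IH Y) => ->; rewrite ?orbT.
Qed.

Lemma lex_le_take k X Y : lex_le X Y -> lex_le (take k X) (take k Y).
Proof.
elim: X Y k => [|x X IH] [|y Y] [|k] //=.
by case/orP=> [->//|/andP[-> /IH->]]; rewrite orbT.
Qed.

Definition lex_tie (b : bool) f g k : bool :=
  let l := lcp f g k in if l == k then b else ecode_lt (f l) (g l).

Lemma lex_tie_prepend b x y f g k :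
  lex_tie b (prepend x f) (prepend y g) k.+1 =
  ecode_lt x y || (x == y) && lex_tie b f g k.
Proof.
rewrite /lex_tie lcp_prepend; case: (eqVneq x y) => [->|_]; last by rewrite orbF.
by rewrite ecode_ltxx eqSS.
Qed.

Lemma lex_le_mkseq f g k : lex_le (mkseq f k) (mkseq g k) = lex_tie true f g k.
Proof.
elim: k f g => [|k IH] f g; first by rewrite /lex_tie -leqn0 lcp_le.
rewrite !mkseqSl /= IH /lex_tie lcpS; case: (eqVneq (f 0) (g 0)) => [->|_].
  by rewrite ecode_ltxx eqSS.
by rewrite orbF.
Qed.

Lemma lex_tieE b f g k :
  lex_tie b f g k =
  if mkseq f k == mkseq g k then b else lex_le (mkseq f k) (mkseq g k).
Proof. by rewrite -lcp_eq_full lex_le_mkseq /lex_tie; case: ifP. Qed.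

Lemma zeros_mkseqS f k :
  zeros (mkseq f k.+1) = zeros (mkseq f k) + (f k == inr 0).
Proof. by rewrite /zeros mkseqS -cats1 count_cat /= addn0. Qed.

Lemma leq_zeros_mkseq f : {homo (fun k => zeros (mkseq f k)) : k m / k <= m}.
Proof.
apply: homo_leq => [k|k m l|k]; [exact: leqnn|exact: leq_trans|].
by rewrite zeros_mkseqS leq_addr.
Qed.

Lemma zeros_mkseq_le f k : zeros (mkseq f k) <= k.
Proof. by rewrite -[leqRHS](size_mkseq f) count_size. Qed.

(* This is how the count in the pBWT determines which zero of a row it refers to. *)
Lemma ltn_zeros_mkseq f p q : f p = inr 0 ->
  (zeros (mkseq f q.+1) < zeros (mkseq f p.+1)) = (q < p).
Proof.
move=> fp; rewrite [ltnRHS]zeros_mkseqS fp eqxx addn1 ltnS.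
case: (ltnP q p) => [qp|pq]; first exact: leq_zeros_mkseq.
apply/negbTE; rewrite -ltnNge.
apply: leq_trans (leq_zeros_mkseq f (pq : p.+1 <= q.+1)).
by rewrite zeros_mkseqS fp eqxx addn1.
Qed.

Lemma zeros_prepend x f k :
  zeros (mkseq (prepend x f) k.+1) = (x == inr 0) + zeros (mkseq f k).
Proof. by rewrite mkseqSl. Qed.

(* What becomes of a row f when the symbol whose first occurrence is at p is
   prepended: the entry at p now refers back to the new front. *)
Definition backref (p : nat) f (q : nat) : ecode Ss :=
  if q == p then inr q.+1 else f q.

Definition back_bounded f k : Prop := forall q v, q < k -> f q = inr v -> v <= q.

Lemma backref_at p f : backref p f p = inr p.+1.
Proof. by rewrite /backref eqxx. Qed.

Lemma backref_neq p f q : q != p -> backref p f q = f q.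
Proof. by rewrite /backref => /negPf->. Qed.

Lemma ecode_lt_backref p f k :
  back_bounded f k -> p < k -> ecode_lt (f p) (inr p.+1).
Proof. by move=> bf pk; case e: (f p) => [s|v] //=; rewrite ltnS (bf p). Qed.

Lemma lcp_backref f g k p p' :
  back_bounded f k -> back_bounded g k ->
  (p < k -> f p = inr 0) -> (p' < k -> g p' = inr 0) ->
  lcp (backref p f) (backref p' g) k =
  if p == p' then lcp f g k else minn (lcp f g k) (minn p p').
Proof.
wlog le_pp : f g p p' / p <= p' => [wlog_le|] bf bg fp gp.
  case/orP: (leq_total p p') => pp; first exact: wlog_le.
  by rewrite lcpC wlog_le // eq_sym [lcp g f k]lcpC [minn p' p]minnC.
have lk := lcp_le f g k.
have eq_l q : q < lcp f g k -> f q = g q by exact: eq_before_lcp.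
case: (eqVneq p p') gp le_pp => [<- gp _|ne gp le_pp].
  apply: lcp_unique => // [q ql|lk']; first by rewrite /backref eq_l.
  rewrite !backref_neq; first exact: neq_at_lcp.
  - by apply: lcp_neq => // pk; rewrite fp // gp.
  - by apply: lcp_neq => // pk; rewrite fp // gp.
have {ne le_pp} pp : p < p' by rewrite ltn_neqAle ne.
rewrite (minn_idPl (ltnW pp)); apply: lcp_unique; first by rewrite geq_min lk.
  by move=> q; rewrite leq_min => /andP[ql qp]; rewrite !backref_neq ?eq_l //; lia.
case: (ltnP (lcp f g k) p) => lp mk.
  by rewrite !backref_neq; [exact: neq_at_lcp|lia|lia].
rewrite backref_at backref_neq; last by lia.
have pk : p < k by lia.
by move/esym/(bg p _ pk); rewrite ltnn.
Qed.

Lemma zeros_backref f p k : (p < k -> f p = inr 0) ->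
  zeros (mkseq (backref p f) k) + (p < k) = zeros (mkseq f k).
Proof.
elim: k => [|k IH] fp //; rewrite !zeros_mkseqS -IH => [|/ltnW/fp //].
case: (eqVneq k p) fp => [->|ne] fp.
  by rewrite backref_at fp ?ltnSn // eqxx ltnn addn0.
by rewrite backref_neq // addnAC ltnS leq_eqVlt eq_sym (negPf ne).
Qed.

(* The row with the smaller p has its entry increased above that of the other
   row, if the two rows agree up to there. *)
Lemma lex_tie_backref b f g k p p' : p <= k -> p' <= k ->
  back_bounded f k -> back_bounded g k ->
  (p < k -> f p = inr 0) -> (p' < k -> g p' = inr 0) ->
  lex_tie b (backref p f) (backref p' g) k =
  if (p != p') && (minn p p' <= lcp f g k) then p' < p else lex_tie b f g k.
Proof.
move=> pk pk' bf bg fp gp; rewrite /lex_tie lcp_backref //.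
have lk := lcp_le f g k; case: (eqVneq p p') gp => [<- gp|ne gp] /=.
  case: ifP => // /negbT nlk; have lk' : lcp f g k < k by rewrite ltn_neqAle nlk.
  have lp : lcp f g k != p by apply: lcp_neq => // p_lt; rewrite fp // gp.
  by rewrite !backref_neq.
case: (ltnP (lcp f g k) (minn p p')) => lm.
  by case: eqP => // _; rewrite !backref_neq //; lia.
rewrite ifN; last by lia.
case: (ltngtP p p') ne => // pp _.
  rewrite backref_at backref_neq; last by lia.
  by apply: ecode_lt_asym; apply: ecode_lt_backref bg _; lia.
rewrite backref_at backref_neq; last by lia.
by apply: ecode_lt_backref bf _; lia.
Qed.

End Lex.

(** * Stable sorting by counting *)

Section Rank.
Variables (I : finType) (r : rel I).
Hypotheses (r_irr : irreflexive r) (r_trans : transitive r).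
Hypothesis r_total : forall x y, x != y -> r x y || r y x.

Definition rank x : nat := #|[pred y | r y x]|.

Lemma ltn_rank x y : r x y -> rank x < rank y.
Proof.
move=> xy; apply/proper_card/properP; split; last by exists x; rewrite inE ?r_irr.
by apply/subsetP => z; rewrite !inE => zx; apply: r_trans xy.
Qed.

Lemma rank_inj : injective rank.
Proof.
by move=> x y e; apply/eqP/contraT => /r_total/orP[]/ltn_rank; rewrite e ltnn.
Qed.

Lemma rank_lt x : rank x < #|I|.
Proof.
apply/proper_card/properP; split; first exact: subset_predT.
by exists x; rewrite ?inE ?r_irr.
Qed.

End Rank.

Lemma sum_pick n (F : nat -> nat) (P : pred nat) i :
  i < n -> P i -> (forall j, j < n -> P j -> j = i) ->
  \sum_(j < n) F j * P j = F i.
Proof.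
move=> il Pi u; rewrite (bigD1 (Ordinal il)) //= Pi muln1 big1 ?addn0 // => j ne.
case Pj: (P j); last by rewrite muln0.
by case/eqP: ne; apply: val_inj; exact: u (ltn_ord j) Pj.
Qed.

Definition table (T : Type) (F : nat -> nat -> T) (n k : nat) : seq (seq T) :=
  mkseq (fun i => mkseq (F i) k) n.

Lemma nth_table (T : Type) (F : nat -> nat -> T) n k i :
  i < n -> nth [::] (table F n k) i = mkseq (F i) k.
Proof. exact: nth_mkseq. Qed.

Section StableSort.
Variables (ds : Order.disp_t) (Ss : finOrderType ds) (n k : nat).
Variable F : nat -> nat -> ecode Ss.

Definition row_lt i j : bool := lex_tie (i < j) (F i) (F j) k.

(* The position of row i among the n rows sorted by their first k entries, and
   the row that comes to position a. *)
Definition position i := \sum_(j < n) row_lt j i.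
Definition source a := \sum_(i < n) i * (position i == a).

Let r (i j : 'I_n) := row_lt i j.

Let r_irr : irreflexive r.
Proof. by move=> i; rewrite /r /row_lt lex_tieE eqxx ltnn. Qed.

Let r_trans : transitive r.
Proof.
move=> y x z; rewrite /r /row_lt !lex_tieE.
move: (mkseq (F x) k) (mkseq (F y) k) (mkseq (F z) k) => X Y Z.
case: (eqVneq X Y) => [<-|xy]; first by case: (eqVneq X Z) => // _; exact: ltn_trans.
case: (eqVneq Y Z) => [<-|yz]; first by rewrite (negPf xy).
move=> lexy leyz; case: eqP => [e|_]; last exact: lex_le_trans leyz.
by case/eqP: xy; apply: lex_le_anti; rewrite lexy e.
Qed.

Let r_total i j : i != j -> r i j || r j i.
Proof.
rewrite /r /row_lt !lex_tieE [mkseq (F j) k == _]eq_sym => ij.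
by case: eqP => _; [rewrite -neq_ltn|exact: lex_le_total].
Qed.

Let positionE (i : 'I_n) : position i = rank r i.
Proof. by rewrite /rank -sum1_card big_mkcond. Qed.

Lemma position_le i : position i <= n.
Proof.
rewrite /position -[leqRHS]card_ord -sum1_card.
by apply: leq_sum => j _; case: row_lt.
Qed.

Lemma ltn_position i j : i < n -> j < n -> row_lt i j -> position i < position j.
Proof.
move=> il jl ij; rewrite !(positionE (Ordinal il), positionE (Ordinal jl)).
exact: ltn_rank.
Qed.

Lemma source_spec a : a < n -> source a < n /\ position (source a) = a.
Proof.
move=> al; have rl i : rank r i < n by rewrite -[ltnRHS]card_ord rank_lt.
have rank_ord_inj : injective (fun i => Ordinal (rl i)).
  by move=> i j [/(rank_inj r_irr r_trans r_total)].
have [g _ /(_ (Ordinal al))[pos_g]] := injF_bij rank_ord_inj.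
move: (g _) pos_g => i; rewrite -positionE => pos_i.
suff -> : source a = i by rewrite ltn_ord.
apply: (@sum_pick n id (fun j => position j == a)) => [||j jl /eqP pos_j] //.
  exact/eqP.
apply: (congr1 val (rank_ord_inj (Ordinal jl) i _)); apply: val_inj.
by rewrite /= -!positionE pos_i.
Qed.

Lemma source_lt a : a < n -> source a < n. Proof. by case/source_spec. Qed.

Lemma positionK a : a < n -> position (source a) = a. Proof. by case/source_spec. Qed.

Lemma perm_source : perm_eq (mkseq source n) (iota 0 n).
Proof.
have uniq_source : uniq (mkseq source n).
  rewrite map_inj_in_uniq ?iota_uniq // => a b; rewrite !mem_iota => /= al bl e.
  by rewrite -[a]positionK // e positionK.
apply: uniq_perm; rewrite ?iota_uniq //.
apply: (uniq_min_size uniq_source _ _).2; last by rewrite size_mkseq size_iota.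
by move=> i /mapP[a]; rewrite !mem_iota => /= al ->; exact: source_lt.
Qed.

Lemma sorted_table_source : sorted (@lex_le _ Ss) (table (F \o source) n k).
Proof.
apply/(sortedP [::]) => a; rewrite size_mkseq => al; have al' := ltnW al.
rewrite !nth_table //=; apply: contraT => nle.
have lt_src : row_lt (source a.+1) (source a).
  move: nle; rewrite /row_lt lex_tieE.
  move: (mkseq (F (source a)) k) (mkseq (F (source a.+1)) k) => X Y.
  case: eqP => [->|_ /negPf nle]; first by rewrite lex_le_refl.
  by have := lex_le_total X Y; rewrite nle.
have := ltn_position (source_lt al) (source_lt al') lt_src.
by rewrite !positionK // ltnNge leqnSn.
Qed.

Lemma source_sorts E a q :
  perm_eq (table F n k) (table E n k) -> sorted (@lex_le _ Ss) (table E n k) ->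
  a < n -> q < k -> F (source a) q = E a q.
Proof.
move=> permFE sortedE al qk.
have eq_tables : table (F \o source) n k = table E n k.
  apply: (sorted_eq (@lex_le_trans _ Ss) (@lex_le_anti _ Ss)) => //.
    exact: sorted_table_source.
  apply: perm_trans permFE.
  rewrite /table /mkseq (map_comp (fun i => mkseq (F i) k) source).
  exact: perm_map perm_source.
have := congr1 (fun t => nth (inr 0) (nth [::] t a) q) eq_tables.
by rewrite !nth_table // !nth_mkseq.
Qed.

End StableSort.

Lemma row_lt_sorted (ds : Order.disp_t) (Ss : finOrderType ds) n k
    (E : nat -> nat -> ecode Ss) i j :
  sorted (@lex_le _ Ss) (table E n k) -> i < n -> j < n -> row_lt k E i j = (i < j).
Proof.
move=> sortedE il jl.
have le_rows i' j' : i' <= j' -> j' < n -> lex_le (mkseq (E i') k) (mkseq (E j') k).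
  move=> ij jl'; have il' := leq_ltn_trans ij jl'.
  rewrite -!(nth_table E k (n := n)) //.
  apply: (sorted_leq_nth (@lex_le_trans _ Ss) (@lex_le_refl _ Ss)) => //.
    by rewrite inE size_mkseq.
  by rewrite inE size_mkseq.
rewrite /row_lt lex_tieE; case: eqP => // ne; case: (ltnP i j) => [/ltnW ij|ji].
  exact: le_rows.
by apply/negP => leij; apply: ne; apply: lex_le_anti; rewrite leij le_rows.
Qed.

(** * Prev-encodings *)

Lemma bigmax_ord_eq q (P : pred nat) m :
  m < q -> P m -> (forall j, m < j < q -> ~~ P j) ->
  \max_(j < q | P j) (j : nat) = m.
Proof.
move=> mq Pm notP; apply/eqP; rewrite eqn_leq; apply/andP; split.
  apply/bigmax_leqP => j Pj; rewrite leqNgt; apply/negP => mj.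
  by have := notP j; rewrite mj ltn_ord Pj => /(_ isT).
by have := @leq_bigmax_cond _ (fun j : 'I_q => P j) val (Ordinal mq) Pm.
Qed.

Section PrevEnc.
Variables (ds dp : Order.disp_t) (Ss : finOrderType ds) (Sp : finOrderType dp).
Implicit Types (x w : seq (psym Ss Sp)) (c d : psym Ss Sp) (p : Sp).

Lemma size_prev_enc w : size (prev_enc w) = size w.
Proof. by rewrite size_image card_ord. Qed.

Lemma nth_prev_enc e0 c0 w q :
  q < size w -> nth e0 (prev_enc w) q = prev_sym w q (nth c0 w q).
Proof.
move=> ql; rewrite /prev_enc (nth_map (Ordinal ql)) ?size_enum_ord //.
rewrite (_ : nth _ _ q = Ordinal ql); last exact: (nth_ord_enum _ (Ordinal ql)).
by rewrite (tnth_nth c0).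
Qed.

Lemma prev_sym_new w q p : inr p \notin take q w -> prev_sym w q (inr p) = inr 0.
Proof. by rewrite /prev_sym => /negPf->. Qed.

Lemma prev_sym_old w q p : inr p \in take q w ->
  exists m, [/\ m < q, nth (inr p) w m = inr p,
     forall j, m < j < q -> nth (inr p) w j != inr p
   & prev_sym w q (inr p) = inr (q - m)].
Proof.
move=> pw; pose occurs m := (m < q) && (nth (inr p) w m == inr p).
have occurrence : exists m, occurs m.
  have /(nthP (inr p))[m m_lt e] := pw; exists m.
  have mq : m < q by apply: leq_trans m_lt _; rewrite size_take; case: ltnP.
  by rewrite /occurs mq -(nth_take _ mq) e eqxx.
have occurs_le m : occurs m -> m <= q by case/andP=> /ltnW.
have [m /andP[mq /eqP e] last_m] := ex_maxnP occurrence occurs_le.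
have no_later j : m < j < q -> nth (inr p) w j != inr p.
  move=> /andP[mj jq]; apply/negP => ej; have := last_m j.
  by rewrite /occurs jq ej => /(_ isT); rewrite leqNgt mj.
exists m; split=> //; rewrite /prev_sym pw.
by rewrite (@bigmax_ord_eq q (fun j => nth (inr p) w j == inr p) m) //; apply/eqP.
Qed.

Lemma prev_sym_le w q c v : prev_sym w q c = inr v -> v <= q.
Proof.
case: c => [s|p] //; case: (boolP (inr p \in take q w)) => old.
  by case: (prev_sym_old old) => m [_ _ _ ->] [<-]; exact: leq_subr.
by rewrite prev_sym_new // => -[<-].
Qed.

Lemma prev_sym_eq0 w q c :
  (prev_sym w q c == inr 0) = if c is inr p then inr p \notin take q w else false.
Proof.
case: c => [s|p] //; case: (boolP (inr p \in take q w)) => old.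
  by case: (prev_sym_old old) => m [mq _ _ ->]; apply/negP => /eqP[e]; lia.
by rewrite prev_sym_new ?eqxx.
Qed.

Lemma prev_sym_back w q c v :
  prev_sym w q c = inr v -> 0 < v -> nth c w (q - v) = c.
Proof.
case: c => [s|p] //; case: (boolP (inr p \in take q w)) => old.
  by case: (prev_sym_old old) => m [mq e _ ->] [<-] _; rewrite subKn // ltnW.
by rewrite prev_sym_new // => -[<-].
Qed.

Lemma prev_sym_take w k q c :
  q <= k -> k <= size w -> prev_sym (take k w) q c = prev_sym w q c.
Proof.
case: c => [s|p] // qk kw; rewrite /prev_sym take_takel //; case: ifP => // _.
congr (inr (_ - _)); apply: eq_bigl => j.
by rewrite nth_take // (leq_trans (ltn_ord j)).
Qed.

Lemma prev_sym_rcons w q c d :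
  q <= size w -> prev_sym (rcons w d) q c = prev_sym w q c.
Proof.
move=> qw; rewrite -(@prev_sym_take (rcons w d) (size w)) // ?size_rcons //.
by rewrite -cats1 take_size_cat.
Qed.

Lemma prev_enc_rcons w c :
  prev_enc (rcons w c) = rcons (prev_enc w) (prev_sym w (size w) c).
Proof.
apply: (@eq_from_nth _ (inr 0)); first by rewrite size_rcons !size_prev_enc size_rcons.
move=> q; rewrite size_prev_enc size_rcons ltnS => qw.
rewrite (nth_prev_enc _ c) ?size_rcons // !nth_rcons size_prev_enc prev_sym_rcons //.
by case: ltngtP qw => // [qw|->] _; first by rewrite (nth_prev_enc _ c).
Qed.

Lemma prev_enc_take k w : prev_enc (take k w) = take k (prev_enc w).
Proof.
elim/last_ind: w => [|w c IH]; first by rewrite !take_oversize ?size_prev_enc.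
have [kw|kw] := leqP k (size w).
  by rewrite prev_enc_rcons -!cats1 !takel_cat ?size_prev_enc ?IH.
by rewrite !take_oversize ?size_prev_enc ?size_rcons.
Qed.

Lemma zeros_prev_enc w : zeros (prev_enc w) = #|[pred p : Sp | inr p \in w]|.
Proof.
elim/last_ind: w => [|w c IH].
  by rewrite (size0nil (size_prev_enc [::])) eq_card0.
rewrite prev_enc_rcons /zeros -cats1 count_cat -/(zeros _) IH /= addn0.
rewrite prev_sym_eq0 take_size; case: c => [s|p].
  by rewrite addn0; apply: eq_card => p; rewrite !inE mem_rcons inE.
have same : [predD1 [pred p' : Sp | inr p' \in w] & p] =i
            [predD1 [pred p' : Sp | inr p' \in rcons w (inr p)] & p].
  move=> p'; rewrite !inE mem_rcons inE; case: eqVneq => //= ne.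
  by rewrite (inj_eq (@inr_inj _ _)) (negPf ne).
rewrite (cardD1 p) [RHS](cardD1 p) !inE mem_rcons inE eqxx (eq_card same) addnAC.
by case: (inr p \in w).
Qed.

Lemma eq_index (T : eqType) (x : T) s i :
  i < size s -> (i == index x s) = (nth x s i == x) && (x \notin take i s).
Proof.
move=> il; apply/eqP/andP => [e|[/eqP e n]].
  by rewrite in_take_leq -?e ?(ltnW il) // ltnn {1}e nth_index // -index_mem -e.
apply/eqP; move: n; rewrite in_take_leq ?(ltnW il) // eqn_leq -leqNgt => -> /=.
by rewrite -{1}e index_nth.
Qed.

Definition is_param c : bool := if c is inr _ then true else false.

Lemma prev_sym_cons c x q d : q < size x -> nth c x q = d ->
  prev_sym (c :: x) q.+1 d =
  if is_param c && (q == index c x) then inr q.+1 else prev_sym x q d.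
Proof.
move=> qx nth_d; rewrite eq_index // nth_d; case: d nth_d => [s|p] nth_p.
  by case: c {nth_p} => [s'|p] //=; rewrite andbF.
rewrite [LHS]/prev_sym take_cons inE; case: (boolP (inr p \in take q x)) => old.
  have [m [mq me no_later ->]] := prev_sym_old old.
  rewrite orbT (@bigmax_ord_eq q.+1 (fun j => nth (inr p) (c :: x) j == inr p) m.+1) //.
  - by rewrite subSS; case: eqVneq old => [<- ->|]; rewrite ?andbF.
  - exact/eqP.
  - by case=> // j /=; rewrite !ltnS => /no_later.
rewrite orbF prev_sym_new //; case: eqVneq old => [<- new|]; last by rewrite andbF.
rewrite new (@bigmax_ord_eq q.+1 (fun j => nth (inr p) (inr p :: x) j == inr p) 0) //=.
case=> // j /=; rewrite ltnS => jq; apply: contra new => /eqP <-.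
by rewrite -(nth_take (n0 := q)) // mem_nth // size_take qx; move: jq; lia.
Qed.

Definition front_code c : ecode Ss := if c is inl s then inl s else inr 0.

Lemma prev_enc_cons c x q : q <= size x ->
  nth (inr 0) (prev_enc (c :: x)) q =
  prepend (front_code c)
    (backref (if is_param c then index c x else size x) (nth (inr 0) (prev_enc x))) q.
Proof.
move=> qx; rewrite (nth_prev_enc _ c) //; case: q qx => [_|q qx] /=.
  by case: c.
rewrite (prev_sym_cons qx erefl) /backref (nth_prev_enc _ c) //.
by case: (is_param c) => //=; rewrite ltn_eqF.
Qed.

End PrevEnc.

Lemma mkseq_nth_take (T : Type) (x0 : T) (s : seq T) k :
  k <= size s -> mkseq (nth x0 s) k = take k s.
Proof.
move=> ks; apply: (@eq_from_nth _ x0); rewrite size_mkseq ?size_takel // => i ik.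
by rewrite nth_mkseq // nth_take.
Qed.

Lemma sum_ltn k m : \sum_(q < k) (q < m) = minn k m.
Proof.
elim: k => [|k IH]; first by rewrite big_ord0 min0n.
by rewrite big_ord_recr /= IH; lia.
Qed.

(** * The rows of the sorted matrix of rotations *)

Section Rows.
Variables (ds dp : Order.disp_t) (Ss : finOrderType ds) (Sp : finOrderType dp).
Variables (dollar : Ss) (n : nat) (T : seq (psym Ss Sp)).
Hypotheses (n_gt0 : 0 < n) (size_T : size T = n).

Notation c0 := (inl dollar : psym Ss Sp).
Notation tau := (rot_order T).

Definition row (i : nat) : seq (psym Ss Sp) := rot (nth 0 tau i) T.
Definition enc (i : nat) : nat -> ecode Ss := nth (inr 0) (prev_enc (row i)).
Definition row_last (i : nat) : psym Ss Sp := last c0 (row i).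
Definition front (i : nat) : ecode Ss := front_code (row_last i).
Definition zeros_upto (i q : nat) : nat := zeros (mkseq (enc i) q.+1).

(* Where the last symbol of row i first occurs, if it is a p-symbol that occurs
   among the first k symbols, and k otherwise. *)
Definition pivot (k i : nat) : nat :=
  minn k (if is_param (row_last i) then index (row_last i) (row i) else n).

(* The row of the rotation that begins with the last symbol of row i. *)
Definition shifted (k i : nat) : nat -> ecode Ss :=
  prepend (front i) (backref (pivot k i) (enc i)).

Lemma size_row i : size (row i) = n.
Proof. by rewrite size_rot size_T. Qed.

Lemma size_tau : size tau = n.
Proof. by rewrite size_sort size_iota. Qed.

Lemma size_pbwt : size (pbwt c0 T) = n.
Proof. by rewrite size_map size_tau. Qed.

Lemma perm_tau : perm_eq tau (iota 0 n).
Proof. by rewrite perm_sort size_T. Qed.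

Lemma row_rcons i : exists2 x, row i = rcons x (row_last i) & size x = n.-1.
Proof.
rewrite /row_last; have := size_row i; case: (lastP (row i)) => [|x c].
  by move=> e; move: n_gt0; rewrite -e.
by rewrite last_rcons size_rcons => e; exists x => //; rewrite -e.
Qed.

Lemma row_last_in i : row_last i \in row i.
Proof. by case: (row_rcons i) => x -> _; rewrite mem_rcons inE eqxx. Qed.

Lemma encE i q : q < n -> enc i q = prev_sym (row i) q (nth c0 (row i) q).
Proof. by move=> ql; rewrite /enc (nth_prev_enc _ c0) // size_row. Qed.

Lemma mkseq_enc i k : k <= n -> mkseq (enc i) k = take k (prev_enc (row i)).
Proof. by move=> kn; apply: mkseq_nth_take; rewrite size_prev_enc size_row. Qed.

Lemma enc_bounded i k : k <= n -> back_bounded (enc i) k.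
Proof. by move=> kn q v qk; rewrite encE ?(leq_trans qk) //; apply: prev_sym_le. Qed.

Lemma pivot_le k i : pivot k i <= k.
Proof. exact: geq_minl. Qed.

Lemma enc_row_last i :
  is_param (row_last i) -> enc i (index (row_last i) (row i)) = inr 0.
Proof.
have := row_last_in i; rewrite -index_mem size_row => idx.
rewrite encE // nth_index ?row_last_in //; case: (row_last i) idx => // p idx _.
by rewrite prev_sym_new // in_take_leq ?size_row ?ltnn // ltnW.
Qed.

Lemma enc_pivot k i : k <= n -> pivot k i < k -> enc i (pivot k i) = inr 0.
Proof.
rewrite /pivot gtn_min ltnn /= => kn; case: ifP => [ip ik|_]; last by rewrite ltnNge kn.
by rewrite (minn_idPr (ltnW ik)) enc_row_last.
Qed.

Lemma table_enc k :
  k <= n -> table enc n k = [seq take k (prev_enc (rot t T)) | t <- tau].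
Proof.
move=> kn; rewrite -[in RHS](mkseq_nth 0 tau) size_tau /mkseq -map_comp.
by apply: eq_map => i /=; rewrite mkseq_enc.
Qed.

Lemma sorted_enc k : k <= n -> sorted (@lex_le _ Ss) (table enc n k).
Proof.
move=> kn; rewrite table_enc //.
apply: (homo_sorted (e := fun t u => lex_le (prev_enc (rot t T)) (prev_enc (rot u T)))).
  by move=> t u; exact: lex_le_take.
by apply: sort_sorted => t u; exact: lex_le_total.
Qed.

Lemma mkseq_shifted k i :
  k < n -> mkseq (shifted k i) k.+1 = take k.+1 (prev_enc (rotr 1 (row i))).
Proof.
move=> kn; have [x e size_x] := row_rcons i.
have kx : k <= size x by lia.
rewrite -(mkseq_nth_take (inr 0)); last by rewrite size_prev_enc size_rotr size_row.
apply/eq_in_map => q; rewrite mem_iota add0n => /= qk.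
rewrite e rotr1_rcons prev_enc_cons; last by lia.
rewrite /shifted /front /prepend; case: q qk => // q qk.
have qx : q < size x by lia.
have enc_x : enc i q = nth (inr 0) (prev_enc x) q.
  by rewrite /enc e prev_enc_rcons nth_rcons size_prev_enc qx.
rewrite /backref enc_x /pivot e -cats1 index_cat /= eqxx; congr (if _ then _ else _).
have -> m : (q == minn k m) = (q == m) by lia.
case: (is_param _); last by rewrite !ltn_eqF //; lia.
by case: ifP => // /negbT/memNindex ->; rewrite addn0.
Qed.

Lemma perm_shifted k :
  k < n -> perm_eq (table (shifted k) n k.+1) (table enc n k.+1).
Proof.
move=> kn; rewrite table_enc //.
pose prefix t := take k.+1 (prev_enc (rot t T)).
pose prefix_before t := take k.+1 (prev_enc (rotr 1 (rot t T))).
have -> : table (shifted k) n k.+1 = map prefix_before tau.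
  rewrite -[in RHS](mkseq_nth 0 tau) size_tau /mkseq -map_comp.
  by apply: eq_map => i /=; rewrite mkseq_shifted.
apply: (@perm_trans _ (map prefix_before (iota 0 n))); first exact/perm_map/perm_tau.
apply: (@perm_trans _ (map prefix (iota 0 n))); last first.
  by rewrite perm_sym; exact/perm_map/perm_tau.
case: n n_gt0 size_T => // m _ size_T'.
have -> : map prefix_before (iota 0 m.+1) = prefix m :: map prefix (iota 0 m).
  rewrite /= (iotaDl 1 0) -map_comp; congr (_ :: _).
    by rewrite /prefix_before /prefix rot0 /rotr size_T' subn1.
  apply/eq_in_map => t; rewrite mem_iota add0n /= => tm.
  by rewrite /prefix_before /prefix add1n rotS ?rotK // size_T' ltnW.
by rewrite -addn1 iotaD map_cat add0n perm_sym perm_catC perm_refl.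
Qed.

Lemma pbwt_nth i : i < n ->
  nth (inr 0) (pbwt c0 T) i =
  if row_last i is inl s then inl s
  else inr (zeros_upto i (index (row_last i) (row i))).
Proof.
move=> il; rewrite (nth_map 0) ?size_tau //= -/(row i) -/(row_last i).
have := row_last_in i; rewrite -index_mem size_row.
by case: (row_last i) => [s|p] //= idx; rewrite /zeros_upto prev_enc_take mkseq_enc.
Qed.

Definition front_count (i : nat) : nat :=
  if is_param (row_last i) then zeros_upto i (index (row_last i) (row i)) else n.+1.

Lemma sum_zeros_upto k i :
  k <= n -> \sum_(q < k) (zeros_upto i q < front_count i) = pivot k i.
Proof.
move=> kn; rewrite /pivot -sum_ltn; apply: eq_bigr => q _; congr (nat_of_bool _).
have qn := leq_trans (ltn_ord q) kn; rewrite /front_count.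
case: ifP => [/enc_row_last/ltn_zeros_mkseq-> //|_].
by rewrite qn ltnS (leq_trans (zeros_mkseq_le _ _)).
Qed.

Definition start : nat := index 0 tau.

Lemma start_lt : start < n.
Proof. by rewrite -size_tau index_mem (perm_mem perm_tau) mem_iota. Qed.

Lemma row_start : row start = T.
Proof. by rewrite /row nth_index ?rot0 // -index_mem size_tau start_lt. Qed.

Lemma enc_startP q : q < n ->
  match enc start q with
  | inl s => nth c0 T q = inl s
  | inr _ => is_param (nth c0 T q)
  end.
Proof.
by move=> ql; rewrite encE // row_start; case: (nth c0 T q) => //= p; case: ifP.
Qed.

Lemma enc_back q v : q < n -> enc start q = inr v -> 0 < v ->
  v <= q /\ nth c0 T (q - v) = nth c0 T q.
Proof.
move=> ql; rewrite encE // row_start => e v_gt0; split; first exact: prev_sym_le e.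
rewrite -[RHS](prev_sym_back e v_gt0); apply: set_nth_default.
by rewrite size_T (leq_ltn_trans (leq_subr _ _)).
Qed.

(* The p-symbols in the order of their first occurrences in T, followed by those
   that do not occur. *)
Definition name_key (p : Sp) : nat := index (inr p) (T ++ [seq inr p' | p' <- enum Sp]).

Definition name_lt (p p' : Sp) : bool := name_key p < name_key p'.

Lemma name_key_inj : injective name_key.
Proof.
have occurs p : inr p \in T ++ [seq inr p' | p' <- enum Sp].
  by rewrite mem_cat map_f ?orbT // mem_enum.
by move=> p p' /(index_inj (inr p) (occurs p) (occurs p'))[].
Qed.

Lemma name_lt_irr : irreflexive name_lt.
Proof. by move=> p; rewrite /name_lt ltnn. Qed.

Lemma name_lt_trans : transitive name_lt.
Proof. by move=> p' p p''; exact: ltn_trans. Qed.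

Lemma name_lt_total p p' : p != p' -> name_lt p p' || name_lt p' p.
Proof. by rewrite -(inj_eq name_key_inj) neq_ltn. Qed.

Definition rename (p : Sp) : Sp :=
  Order.enum_val (Ordinal (rank_lt name_lt_irr p)).

Lemma enum_rank_rename p : Order.enum_rank (rename p) = rank name_lt p :> nat.
Proof. by rewrite /rename Order.enum_valK. Qed.

Lemma rename_bij : bijective rename.
Proof.
apply: injF_bij => p p' e; apply: (rank_inj name_lt_irr name_lt_trans name_lt_total).
by rewrite -!enum_rank_rename e.
Qed.

Lemma rename_first q p : q < n -> nth c0 T q = inr p -> enc start q = inr 0 ->
  Order.enum_rank (rename p) = zeros_upto start q - 1 :> nat.
Proof.
move=> ql Tq e0; rewrite enum_rank_rename /zeros_upto zeros_mkseqS e0 eqxx addnK.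
rewrite mkseq_enc ?row_start -?prev_enc_take ?zeros_prev_enc; last exact: ltnW.
have new : inr p \notin take q T.
  by move/eqP: e0; rewrite encE // row_start Tq prev_sym_eq0.
have key_p : name_key p = q.
  have pT : inr p \in T by rewrite -Tq mem_nth // size_T.
  apply/eqP; rewrite /name_key index_cat pT eq_sym eq_index ?size_T //.
  by rewrite (set_nth_default c0) ?size_T // Tq eqxx.
apply: eq_card => p'; rewrite !inE /name_lt key_p /name_key.
by rewrite -in_take_leq ?size_cat ?size_T 1?ltnW ?ltn_addr // takel_cat // size_T ltnW.
Qed.

Lemma front_eq0 i : (front i == inr 0) = is_param (row_last i).
Proof. by rewrite /front; case: (row_last i). Qed.

Lemma nth_tau_lt i : i < n -> nth 0 tau i < n.
Proof.
move=> il; have : nth 0 tau i \in tau by rewrite mem_nth ?size_tau.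
by rewrite (perm_mem perm_tau) mem_iota.
Qed.

Lemma row_lastE i :
  i < n -> row_last i = nth c0 T (if nth 0 tau i is t.+1 then t else n.-1).
Proof.
move=> /nth_tau_lt; rewrite /row_last /row; case: (nth 0 tau i) => [|t] tl.
  by rewrite rot0 -nth_last size_T.
rewrite /rot last_cat -nth_last size_take size_T tl.
by rewrite (set_nth_default c0) ?size_take ?size_T ?tl // nth_take.
Qed.

Lemma front_start i :
  (forall q, q < n -> (nth c0 T q == c0) = (q.+1 == n)) -> i < n ->
  (front i == inl dollar) = (i == start).
Proof.
move=> T_dollar il; have -> : (i == start) = (nth 0 tau i == 0).
  rewrite -[X in _ = (_ == X)](@nth_index _ 0 0 tau); last first.
    by rewrite -index_mem size_tau start_lt.
  by rewrite nth_uniq ?size_tau ?start_lt // (perm_uniq perm_tau) iota_uniq.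
have -> : (front i == inl dollar) = (row_last i == c0).
  by rewrite /front; case: (row_last i).
rewrite row_lastE //.
by case: (nth 0 tau i) (nth_tau_lt il) => [|t] tl; rewrite T_dollar; lia.
Qed.

Section NextColumn.
Variable k : nat.
Hypothesis k_lt : k < n.
Notation src := (source n k.+1 (shifted k)).

Lemma row_lt_shifted i j : i < n -> j < n ->
  row_lt k.+1 (shifted k) i j =
  ecode_lt (front i) (front j) || (front i == front j) &&
    (if (pivot k i != pivot k j) &&
        (minn (pivot k i) (pivot k j) <= lcp (enc i) (enc j) k)
     then pivot k j < pivot k i else i < j).
Proof.
move=> il jl; have kn := ltnW k_lt.
rewrite /row_lt lex_tie_prepend lex_tie_backref ?pivot_le //; try exact: enc_bounded.
- by have := row_lt_sorted (sorted_enc kn) il jl; rewrite /row_lt => ->.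
- exact: enc_pivot.
- exact: enc_pivot.
Qed.

Lemma enc_src a q : a < n -> q <= k -> enc a q = shifted k (src a) q.
Proof.
by move=> al qk; rewrite (source_sorts (perm_shifted k_lt) (sorted_enc k_lt)).
Qed.

Lemma lcp_src a b : a < n -> b < n ->
  lcp (enc a) (enc b) k.+1 =
  let i := src a in let j := src b in
  (front i == front j) *
  ((if pivot k i == pivot k j then lcp (enc i) (enc j) k
    else minn (lcp (enc i) (enc j) k) (minn (pivot k i) (pivot k j))) + 1).
Proof.
move=> al bl /=; have kn := ltnW k_lt.
rewrite (@eq_in_lcp _ _ _ (shifted k (src a)) (shifted k (src b)) k.+1);
  try by move=> q; apply: enc_src.
rewrite lcp_prepend lcp_backref; try exact: enc_bounded; try exact: enc_pivot.
by case: (_ == _); rewrite ?mul1n ?addn1.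
Qed.

Lemma zeros_src a q : a < n -> q <= k ->
  zeros_upto a q + (pivot k (src a) < q) =
  (front (src a) == inr 0) + zeros (mkseq (enc (src a)) q).
Proof.
move=> al qk; have kn := ltnW k_lt.
have -> : zeros_upto a q = zeros (mkseq (shifted k (src a)) q.+1).
  congr zeros; apply/eq_in_map => j; rewrite mem_iota ltnS => /= jq.
  by rewrite enc_src ?(leq_trans jq).
rewrite zeros_prepend -addnA zeros_backref // => pq.
by apply: enc_pivot (leq_trans pq qk).
Qed.

End NextColumn.

End Rows.

(** * Rules for expressions and array comprehensions *)

Definition same_but (f : nat) (A A' : store) : Prop :=
  forall f' i j, f' != f -> A' f' i j = A f' i j.

Lemma same_but_set f A A' i j v : same_but f A A' -> same_but f A (set_cell A' f i j v).
Proof. by move=> same f' i' j' ne; rewrite /set_cell (negPf ne) same. Qed.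

(* In both comprehensions the first index runs over 0, ..., n - 1, where n is
   variable 0, and d is the number of variables in scope. *)
Definition fill_vector (d f : nat) (e : expr) : stmt :=
  SFor (EVar 0) (SStore f (EVar d) (ECst 0) e).

Definition fill_matrix (d f : nat) (b e : expr) : stmt :=
  SFor (EVar 0) (SFor b (SStore f (EVar d) (EVar d.+1) e)).

Section Rules.
Variables (K n B : nat).
Hypothesis B_gt1 : 1 < B.
Notation evals := (evals K n B).
Notation wp := (wp K n B).
Implicit Types (rho : seq nat) (A : store).

Lemma evals_eq rho A e v v' : v = v' -> evals rho A e v -> evals rho A e v'.
Proof. by move=> <-. Qed.

Lemma evals_cst rho A c : c < B -> evals rho A (ECst c) c.
Proof. by []. Qed.

Lemma evals_add rho A e1 e2 x y : evals rho A e1 x -> evals rho A e2 y ->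
  x + y < B -> evals rho A (EBin AAdd e1 e2) (x + y).
Proof. by move=> ev1 ev2 xyB; exists x, y. Qed.

Lemma evals_mul rho A e1 e2 x y : evals rho A e1 x -> evals rho A e2 y ->
  x * y < B -> evals rho A (EBin AMul e1 e2) (x * y).
Proof. by move=> ev1 ev2 xyB; exists x, y. Qed.

Lemma evals_sub rho A e1 e2 x y : evals rho A e1 x -> evals rho A e2 y ->
  y <= x -> evals rho A (EBin ASub e1 e2) (x - y).
Proof. by move=> ev1 ev2 yx; exists x, y. Qed.

Lemma bool_lt (b : bool) : b < B.
Proof. by apply: leq_ltn_trans B_gt1; case: b. Qed.

Lemma evals_ltn rho A e1 e2 x y : evals rho A e1 x -> evals rho A e2 y ->
  evals rho A (EBin ALt e1 e2) (x < y).
Proof. by move=> ev1 ev2; exists x, y; split=> //; apply: bool_lt. Qed.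

Lemma evals_eqn rho A e1 e2 (x y : nat) : evals rho A e1 x -> evals rho A e2 y ->
  evals rho A (EBin AEq e1 e2) (x == y).
Proof. by move=> ev1 ev2; exists x, y; split=> //; apply: bool_lt. Qed.

Lemma evals_and rho A e1 e2 (b1 b2 : bool) : evals rho A e1 b1 -> evals rho A e2 b2 ->
  evals rho A (EBin AMul e1 e2) (b1 && b2).
Proof. by rewrite -mulnb => ev1 ev2; apply: evals_mul => //; rewrite mulnb bool_lt. Qed.

Lemma evals_xor rho A e1 e2 (b1 b2 : bool) : evals rho A e1 b1 -> evals rho A e2 b2 ->
  b1 && b2 = false -> evals rho A (EBin AAdd e1 e2) (b1 || b2).
Proof.
move=> ev1 ev2 b12; have orE : (b1 || b2) = b1 + b2 :> nat.
  by case: b1 b2 b12 {ev1 ev2} => [] [].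
by rewrite orE; apply: evals_add => //; rewrite -orE bool_lt.
Qed.

Lemma evals_cell rho A f e1 e2 i j v : evals rho A e1 i -> evals rho A e2 j ->
  cell_valid K n f i j -> A f i j = v -> evals rho A (ECell f e1 e2) v.
Proof. by move=> ev1 ev2 valid <-; exists i, j. Qed.

Lemma evals_then rho A e1 e2 e3 x v :
  evals rho A e1 x -> 0 < x -> evals rho A e2 v -> evals rho A (EIf e1 e2 e3) v.
Proof. by rewrite lt0n => ev1 x0 ev2; exists x; rewrite // (negPf x0). Qed.

Lemma evals_else rho A e1 e2 e3 v :
  evals rho A e1 0 -> evals rho A e3 v -> evals rho A (EIf e1 e2 e3) v.
Proof. by exists 0. Qed.

Lemma evals_if rho A e1 e2 e3 (b : bool) y z : evals rho A e1 b ->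
  (b -> evals rho A e2 y) -> (~~ b -> evals rho A e3 z) ->
  evals rho A (EIf e1 e2 e3) (if b then y else z).
Proof.
case: b => ev1 ev2 ev3; first exact: evals_then ev1 isT (ev2 isT).
exact: evals_else ev1 (ev3 isT).
Qed.

Lemma evals_sum rho A e1 e2 m (F : nat -> nat) : evals rho A e1 m -> m <= n ->
  (forall i, i < m -> evals (rcons rho i) A e2 (F i)) -> \sum_(i < m) F i < B ->
  evals rho A (ESum e1 e2) (\sum_(i < m) F i).
Proof. by move=> ev1 mn ev2 sumB; exists m, F. Qed.

Lemma wp_mono rho s (Q Q' : store -> Prop) A :
  (forall A', Q A' -> Q' A') -> wp rho s Q A -> wp rho s Q' A.
Proof.
elim: s rho Q Q' A => [f e1 e2 e3|s1 IH1 s2 IH2|e s IH] rho Q Q' A QQ' /=.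
- by move=> [i [j [v [ev1 ev2 ev3 valid /QQ' q]]]]; exists i, j, v.
- by apply: IH1 => A'; apply: IH2.
- by move=> [m [Inv [ev mn inv0 invS invQ]]]; exists m, Inv; split=> // A' /invQ/QQ'.
Qed.

Lemma wp_seq rho s1 s2 Q A :
  wp rho s1 (wp rho s2 Q) A -> wp rho (SSeq s1 s2) Q A.
Proof. by []. Qed.

Lemma wp_fill_vector rho f e F Q A :
  f < K ->
  (forall i A', i < n -> same_but f.+1 A A' ->
     (forall i', i' < i -> A' f.+1 i' 0 = F i') ->
     evals (rcons (n :: rho) i) A' e (F i)) ->
  (forall A', same_but f.+1 A A' -> (forall i, i < n -> A' f.+1 i 0 = F i) -> Q A') ->
  wp (n :: rho) (fill_vector (size (n :: rho)) f.+1 e) Q A.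
Proof.
move=> fK ev_e post.
exists n, (fun i A' => same_but f.+1 A A' /\ forall i', i' < i -> A' f.+1 i' 0 = F i').
split=> // [i A' il [sb filled]|A' [sb filled]]; last exact: post.
have n_gt0 : 0 < n by apply: leq_ltn_trans il.
exists i, 0, (F i); split.
- by rewrite /= size_rcons nth_rcons ltnn eqxx.
- by split=> //; exact: ltnW.
- exact: ev_e.
- by rewrite /= fK il.
split=> [|i']; first exact: same_but_set.
rewrite ltnS leq_eqVlt /set_cell !eqxx /= andbT.
by case: eqVneq => [->|_] //= /filled.
Qed.

Lemma wp_fill_matrix rho f b e m (P : nat -> nat -> nat -> Prop) Q A :
  f < K -> m <= n ->
  (forall i A', evals (rcons (n :: rho) i) A' b m) ->
  (forall i j A', i < n -> j < m -> same_but f.+1 A A' ->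
     exists2 v, P i j v & evals (rcons (rcons (n :: rho) i) j) A' e v) ->
  (forall A', same_but f.+1 A A' ->
     (forall i j, i < n -> j < m -> P i j (A' f.+1 i j)) -> Q A') ->
  wp (n :: rho) (fill_matrix (size (n :: rho)) f.+1 b e) Q A.
Proof.
move=> fK mn ev_b ev_e post.
exists n, (fun i A' => same_but f.+1 A A' /\
                       forall i' j, i' < i -> j < m -> P i' j (A' f.+1 i' j)).
split=> // [i A' il [sb filled]|A' [sb filled]]; last exact: post.
exists m, (fun j A' => [/\ same_but f.+1 A A',
    forall i' j', i' < i -> j' < m -> P i' j' (A' f.+1 i' j')
  & forall j', j' < j -> P i j' (A' f.+1 i j')]).
split=> // [j A1 jm [sb1 filled1 row_i]|A1 [sb1 filled1 row_i]]; last first.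
  split=> // i' j; rewrite ltnS leq_eqVlt => /orP[/eqP->|]; first exact: row_i.
  exact: filled1.
have [v Pv ev_v] := ev_e i j A1 il jm sb1.
exists i, j, v; split=> //.
- by rewrite /= !size_rcons !nth_rcons size_rcons ltnSn ltnn eqxx ltnW.
- by rewrite /= !size_rcons nth_rcons size_rcons ltnn eqxx.
- by rewrite /= fK il (leq_trans jm).
split=> [|i' j' i'i j'm|j']; first exact: same_but_set.
  by rewrite /set_cell !eqxx ltn_eqF //=; apply: filled1.
rewrite ltnS leq_eqVlt /set_cell !eqxx /=.
by case: eqVneq => [->|_] //= /row_i.
Qed.

End Rules.

Arguments evals : simpl never.
Arguments wp : simpl never.

(** * The inversion program *)

Declare Scope expr_scope.
Delimit Scope expr_scope with X.
Notation "x + y" := (EBin AAdd x y) : expr_scope.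
Notation "x - y" := (EBin ASub x y) : expr_scope.
Notation "x * y" := (EBin AMul x y) : expr_scope.
Notation "x < y" := (EBin ALt x y) : expr_scope.
Notation "x == y" := (EBin AEq x y) : expr_scope.
Arguments EIf (_ _ _)%_X.
Arguments ESum (_ _)%_X.
Arguments ECell f%_N (_ _)%_X.
Arguments SStore f%_N (_ _ _)%_X.
Arguments SFor _%_X _.
Arguments fill_vector (d f)%_N e%_X.
Arguments fill_matrix (d f)%_N (b e)%_X.
Coercion ECst : nat >-> expr.

Notation num_arrays := 14.
Notation fWords := 0.
Notation fTag := 1.
Notation fSymbol := 2.
Notation fCount := 3.
Notation fRow := 4.
Notation fZeros := 5.
Notation fLcp := 6.
Notation fPivot := 7.
Notation fPosition := 8.
Notation fSource := 9.
Notation fNextRow := 10.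
Notation fNextZeros := 11.
Notation fNextLcp := 12.
Notation fName := 13.
Notation fStart := 14.

Section Program.
Local Open Scope expr_scope.
Notation n := (EVar 0).

Definition entry (f : nat) (x : expr) : expr := ECell f x 0%N.

Definition min_expr (x y : expr) : expr := EIf (x < y) x y.

Definition input_tag : expr := ECell fWords (2%N * EVar 1) 0%N.
Definition input_value : expr := ECell fWords (2%N * EVar 1 + 1%N) 0%N.

Definition load_input : stmt :=
  SSeq (fill_vector 1 fTag input_tag)
 (SSeq (fill_vector 1 fSymbol (EIf input_tag 0%N input_value))
       (fill_vector 1 fCount (EIf input_tag input_value (n + 1%N)))).

Definition front_lt_expr (x y : expr) : expr :=
  (entry fTag x < entry fTag y) +
  (entry fTag x == entry fTag y) * (entry fSymbol x < entry fSymbol y).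

Definition front_eq_expr (x y : expr) : expr :=
  (entry fTag x == entry fTag y) * (entry fSymbol x == entry fSymbol y).

Definition row_lt_expr (x y : expr) : expr :=
  let px := entry fPivot x in let py := entry fPivot y in
  front_lt_expr x y +
  front_eq_expr x y *
    EIf ((px == py) + (ECell fLcp x y < min_expr px py)) (x < y) (py < px).

Definition pivot_expr : expr :=
  let i := EVar 2 in let q := EVar 3 in
  ESum (EVar 1) (ECell fZeros i q < entry fCount i).

Definition position_expr : expr := ESum n (row_lt_expr (EVar 3) (EVar 2)).

Definition source_expr : expr :=
  let a := EVar 2 in let i := EVar 3 in ESum n (i * (entry fPosition i == a)).

Definition sort_rows : stmt :=
  SSeq (fill_vector 2 fPivot pivot_expr)
 (SSeq (fill_vector 2 fPosition position_expr)
       (fill_vector 2 fSource source_expr)).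

(* A row stores a static symbol as a pointer, shifted by n + 1, to an entry of
   the pBWT that holds it: its rank may be too large to be shifted itself. *)
Definition row_expr : expr :=
  let i := entry fSource (EVar 2) in let q := EVar 3 in
  EIf q (EIf (q - 1%N == entry fPivot i) q (ECell fRow i (q - 1%N)))
        (EIf (entry fTag i) 0%N (n + 1%N + i)).

Definition zeros_expr : expr :=
  let i := entry fSource (EVar 2) in let q := EVar 3 in
  entry fTag i +
  EIf q (ECell fZeros i (q - 1%N)) 0%N - (entry fPivot i < q).

Definition lcp_expr : expr :=
  let i := entry fSource (EVar 2) in let j := entry fSource (EVar 3) in
  let pi := entry fPivot i in let pj := entry fPivot j in
  front_eq_expr i j *
    (EIf (pi == pj) (ECell fLcp i j)
                    (min_expr (ECell fLcp i j) (min_expr pi pj)) + 1%N).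

Definition next_columns : stmt :=
  SSeq (fill_matrix 2 fNextRow (EVar 1 + 1%N) row_expr)
 (SSeq (fill_matrix 2 fNextZeros (EVar 1 + 1%N) zeros_expr)
       (fill_matrix 2 fNextLcp n lcp_expr)).

Definition copy_back : stmt :=
  let i := EVar 2 in let j := EVar 3 in
  SSeq (fill_matrix 2 fRow (EVar 1 + 1%N) (ECell fNextRow i j))
 (SSeq (fill_matrix 2 fZeros (EVar 1 + 1%N) (ECell fNextZeros i j))
       (fill_matrix 2 fLcp n (ECell fNextLcp i j))).

Definition round : stmt := SSeq sort_rows (SSeq next_columns copy_back).

Definition start_expr : expr :=
  let i := EVar 1 in
  ESum n (i * ((entry fTag i == 0%N) * (entry fSymbol i == 0%N))).

Definition start_cell (f : nat) : expr := ECell f (ECell fStart 0%N 0%N) (EVar 1).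

Definition name_expr : expr :=
  let q := EVar 1 in let x := start_cell fRow in
  EIf x (EIf (n < x) 0%N (entry fName (q - x))) (start_cell fZeros - 1%N).

Definition output_tag : expr := start_cell fRow < n + 1%N.

Definition output_value : expr :=
  let x := start_cell fRow in
  EIf (n < x) (entry fSymbol (x - (n + 1%N))) (entry fName (EVar 1)).

Definition write_output : stmt :=
  SFor n (SSeq (SStore fWords (2%N * EVar 1) 0%N output_tag)
               (SStore fWords (2%N * EVar 1 + 1%N) 0%N output_value)).

Definition inversion : stmt :=
  SSeq load_input (SSeq (SFor n round)
 (SSeq (SStore fStart 0%N 0%N start_expr)
 (SSeq (fill_vector 1 fName name_expr) write_output))).

Lemma inversion_deg : stmt_deg inversion = 3.
Proof. by []. Qed.

End Program.

(** * Strings as sequences of words *)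

Section Words.
Variables (ds : Order.disp_t) (Ss : finOrderType ds) (A : Type) (code : A -> nat).
Implicit Types X : seq (Ss + A).

Definition word_tag (x : Ss + A) : nat := if x is inr _ then 1 else 0.

Definition word_value (x : Ss + A) : nat :=
  match x with inl s => Order.enum_rank s | inr a => code a end.

Lemma words_cons x X :
  words code (x :: X) = [:: word_tag x, word_value x & words code X].
Proof. by case: x. Qed.

Lemma size_words X : size (words code X) = 2 * size X.
Proof. by elim: X => [|x X IH] //; rewrite words_cons /= IH mulnS. Qed.

Lemma nth_words x0 X q : q < size X ->
  nth 0 (words code X) (2 * q) = word_tag (nth x0 X q) /\
  nth 0 (words code X) (2 * q + 1) = word_value (nth x0 X q).
Proof.
elim: X q => [|x X IH] [|q] //; first by rewrite words_cons.
by rewrite words_cons mulnS /= !ltnS => /IH.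
Qed.

End Words.

(** * Correctness of the inversion program *)

Section Correctness.
Variables (ds dp : Order.disp_t) (Ss : finOrderType ds) (Sp : finOrderType dp).
Variables (dollar : Ss) (n : nat) (T : seq (psym Ss Sp)) (B : nat).
Hypotheses (n_gt0 : 0 < n) (size_T : size T = n) (B_ge : 4 * n + 20 <= B).

Notation c0 := (inl dollar : psym Ss Sp).
Notation enc := (enc T).
Notation row_last := (row_last dollar T).
Notation front := (front dollar T).
Notation front_count := (front_count dollar n T).
Notation pivot := (pivot dollar n T).
Notation shifted := (shifted dollar n T).
Notation zeros_upto := (zeros_upto T).
Notation evals := (evals num_arrays n B).
Notation wp := (wp num_arrays n B).

Implicit Types (A : store) (rho : seq nat) (x y : expr).

Let B_gt1 : 1 < B. Proof. by lia. Qed.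

Definition front_tag (i : nat) : nat := is_param (row_last i).

Definition front_rank (i : nat) : nat :=
  if row_last i is inl s then Order.enum_rank s else 0.

Lemma ltn_enum_rank (s s' : Ss) :
  ((Order.enum_rank s : nat) < Order.enum_rank s') = (s < s')%O.
Proof.
have := Order.le_enum_rank (@le_total _ Ss) s' s; rewrite leEord => rank_le.
by rewrite ltNge -rank_le -ltnNge.
Qed.

Lemma front_ltE i j :
  ecode_lt (front i) (front j) =
  (front_tag i < front_tag j) ||
  (front_tag i == front_tag j) && (front_rank i < front_rank j).
Proof.
rewrite /front /front_tag /front_rank.
by case: (row_last i) (row_last j) => [s|p] [s'|p'] //=; rewrite ltn_enum_rank.
Qed.

Lemma front_eqE i j :
  (front i == front j) = (front_tag i == front_tag j) && (front_rank i == front_rank j).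
Proof.
rewrite /front /front_tag /front_rank.
case: (row_last i) (row_last j) => [s|p] [s'|p'] //=.
by rewrite (inj_eq (@inl_inj _ _)) -(inj_eq (@Order.enum_rank_inj _ _)).
Qed.

Definition codes (v : nat) (e : ecode Ss) : Prop :=
  match e with
  | inr u => v = u
  | inl s => exists2 i, i < n & v = n + 1 + i /\ front i = inl s
  end.

Definition holds_vector (f : nat) (F : nat -> nat) (A : store) : Prop :=
  forall i, i < n -> A f i 0 = F i.

Definition holds_matrix (f m : nat) (P : nat -> nat -> nat -> Prop) (A : store) :
    Prop :=
  forall i j, i < n -> j < m -> P i j (A f i j).

Definition holds_input (A : store) : Prop :=
  [/\ holds_vector fTag front_tag A, holds_vector fSymbol front_rank A
    & holds_vector fCount front_count A].

Definition holds_columns (frow fzeros flcp k : nat) (A : store) : Prop :=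
  [/\ holds_matrix frow k (fun i q v => codes v (enc i q)) A,
      holds_matrix fzeros k (fun i q v => v = zeros_upto i q) A
    & holds_matrix flcp n (fun i j v => v = lcp (enc i) (enc j) k) A].

Definition known (k : nat) (A : store) : Prop :=
  holds_input A /\ holds_columns fRow fZeros fLcp k A.

Lemma vector_frame f f' F A A' :
  same_but f A A' -> f' != f -> holds_vector f' F A -> holds_vector f' F A'.
Proof. by move=> sb ne held i /held; rewrite sb. Qed.

Lemma matrix_frame f f' m P A A' :
  same_but f A A' -> f' != f -> holds_matrix f' m P A -> holds_matrix f' m P A'.
Proof. by move=> sb ne held i j il jm; rewrite sb //; apply: held. Qed.

Lemma input_frame f A A' :
  same_but f A A' -> f \notin [:: fTag; fSymbol; fCount] ->
  holds_input A -> holds_input A'.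
Proof.
rewrite !inE !(eq_sym f) => sb /norP[ne1 /norP[ne2 ne3]] [tags ranks counts].
by split; apply: vector_frame sb _ _.
Qed.

Lemma columns_frame f frow fzeros flcp k A A' :
  same_but f A A' -> f \notin [:: frow; fzeros; flcp] ->
  holds_columns frow fzeros flcp k A -> holds_columns frow fzeros flcp k A'.
Proof.
rewrite !inE !(eq_sym f) => sb /norP[ne1 /norP[ne2 ne3]] [rows zeros lcps].
by split; apply: matrix_frame sb _ _.
Qed.

Lemma known_frame f k A A' : same_but f A A' ->
  f \notin [:: fTag; fSymbol; fCount; fRow; fZeros; fLcp] -> known k A -> known k A'.
Proof.
move=> sb f_other [inp cols]; split.
  by apply: input_frame sb _ inp; move: f_other; rewrite !inE; lia.
by apply: columns_frame sb _ cols; move: f_other; rewrite !inE; lia.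
Qed.

Lemma evals_entry rho A f F x i :
  holds_vector f.+1 F A -> f < num_arrays -> i < n -> evals rho A x i ->
  evals rho A (entry f.+1 x) (F i).
Proof.
move=> held fK il ev_x; apply: (evals_cell (j := 0) ev_x); last exact: held.
- by apply: evals_cst; lia.
- by rewrite /= fK il.
Qed.

Lemma evals_min rho A x y i j : evals rho A x i -> evals rho A y j ->
  evals rho A (min_expr x y) (minn i j).
Proof. by move=> ev_x ev_y; apply: evals_if => //; exact: evals_ltn. Qed.

Section FrontComparison.
Variables (rho : seq nat) (A : store) (x y : expr) (i j : nat).
Hypotheses (A_input : holds_input A) (il : i < n) (jl : j < n).
Hypotheses (ev_x : evals rho A x i) (ev_y : evals rho A y j).

Lemma evals_front_eq : evals rho A (front_eq_expr x y) (front i == front j).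
Proof.
have [tag rank _] := A_input; rewrite front_eqE.
by apply: evals_and => //; apply: evals_eqn => //; exact: evals_entry.
Qed.

Lemma evals_front_lt : evals rho A (front_lt_expr x y) (ecode_lt (front i) (front j)).
Proof.
have [tag rank _] := A_input; rewrite front_ltE.
apply: evals_xor => //; first by apply: evals_ltn => //; exact: evals_entry.
  apply: evals_and => //; first by apply: evals_eqn => //; exact: evals_entry.
  by apply: evals_ltn => //; exact: evals_entry.
by case: ltngtP.
Qed.

End FrontComparison.

Section Round.
Variable k : nat.
Hypothesis k_lt : k < n.
Notation src := (source n k.+1 (shifted k)).
Notation pos := (position n k.+1 (shifted k)).
Notation piv := (pivot k).

Lemma evals_lcp rho A x y i j :
  holds_columns fRow fZeros fLcp k A -> i < n -> j < n ->
  evals rho A x i -> evals rho A y j ->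
  evals rho A (ECell fLcp x y) (lcp (enc i) (enc j) k).
Proof.
move=> [_ _ lcps] il jl ev_x ev_y; apply: (evals_cell ev_x ev_y); last exact: lcps.
by rewrite /= il.
Qed.

Lemma evals_row_lt rho A x y i j : known k A -> holds_vector fPivot piv A ->
  i < n -> j < n -> evals rho A x i -> evals rho A y j ->
  evals rho A (row_lt_expr x y) (row_lt k.+1 (shifted k) i j).
Proof.
move=> [inp cols] pivs il jl ev_x ev_y; rewrite row_lt_shifted //.
have ev_px := evals_entry pivs isT il ev_x; have ev_py := evals_entry pivs isT jl ev_y.
apply: evals_xor => //; first exact: evals_front_lt.
  apply: evals_and => //; first exact: evals_front_eq.
  have ev_cond : evals rho A
      (EBin AAdd (EBin AEq (entry fPivot x) (entry fPivot y))
         (EBin ALt (ECell fLcp x y) (min_expr (entry fPivot x) (entry fPivot y))))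
      ((piv i == piv j) + (lcp (enc i) (enc j) k < minn (piv i) (piv j))).
    apply: evals_add; first exact: evals_eqn.
      by apply: evals_ltn => //; [exact: evals_lcp|exact: evals_min].
    by apply: leq_ltn_trans (leq_add (leq_b1 _) (leq_b1 _)) _; lia.
  case: ifP => [/andP[pij lcp_ge]|/negbT keep]; last first.
    apply: (evals_then _ ev_cond); last exact: evals_ltn.
    by rewrite addn_gt0 !lt0b ltnNge -[piv i == _]negbK -negb_and.
  rewrite (negPf pij) ltnNge lcp_ge in ev_cond.
  by apply: evals_else _ ev_cond _; exact: evals_ltn.
by case: eqP => [->|]; rewrite ?ecode_ltxx ?andbF.
Qed.

Lemma evals_pivot A i :
  known k A -> i < n -> evals [:: n; k; i] A pivot_expr (piv i).
Proof.
move=> [[_ _ counts] [_ zeros _]] il.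
have sumE := sum_zeros_upto dollar n_gt0 size_T i (ltnW k_lt).
apply: (evals_eq sumE).
apply: (evals_sum (m := k) (F := fun q => zeros_upto i q < front_count i)) => //.
- exact: ltnW.
- move=> q qk; apply: evals_ltn => //; last exact: evals_entry.
  apply: (evals_cell (i := i) (j := q)) => //; first by rewrite /= il (ltn_trans qk).
  exact: zeros.
- by rewrite sumE; have := pivot_le dollar n T k i; lia.
Qed.

Lemma evals_position A i : known k A -> holds_vector fPivot piv A -> i < n ->
  evals [:: n; k; i] A position_expr (pos i).
Proof.
move=> kA pivs il.
apply: (evals_sum (m := n) (F := row_lt k.+1 (shifted k) ^~ i)) => //.
- by move=> j jl; apply: evals_row_lt.
- by have := position_le n k.+1 (shifted k) i; rewrite /position; lia.
Qed.

Lemma evals_source A a : holds_vector fPosition pos A -> a < n ->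
  evals [:: n; k; a] A source_expr (src a).
Proof.
move=> positions al.
apply: (evals_sum (m := n) (F := fun i => i * (pos i == a))) => //.
  move=> i il; apply: evals_mul => //; last by case: (pos i == a); lia.
  by apply: evals_eqn => //; exact: evals_entry.
by have := source_lt k.+1 (shifted k) al; rewrite /source; lia.
Qed.

Definition rows_sorted (A : store) : Prop :=
  [/\ known k A, holds_vector fPivot piv A & holds_vector fSource src A].

Lemma rows_sorted_frame f A A' :
  same_but f A A' -> 9 < f -> rows_sorted A -> rows_sorted A'.
Proof.
move=> sb f9 [kA pivs sources]; split.
- by apply: known_frame sb _ kA; rewrite !inE; lia.
- by apply: vector_frame sb _ pivs; lia.
- by apply: vector_frame sb _ sources; lia.
Qed.

Lemma wp_sort_rows A : known k A -> wp [:: n; k] sort_rows rows_sorted A.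
Proof.
move=> known0.
apply: wp_seq; apply: wp_fill_vector => // [i A' il sb _|A1 sb1 pivs].
  by apply: evals_pivot il; apply: known_frame sb _ known0.
have known1 := known_frame sb1 isT known0.
apply: wp_seq; apply: wp_fill_vector => // [i A' il sb _|A2 sb2 positions].
  apply: evals_position il; first exact: known_frame sb _ known1.
  exact: vector_frame sb _ pivs.
apply: wp_fill_vector => // [a A' al sb _|A3 sb3 sources].
  by apply: evals_source al; apply: vector_frame sb _ positions.
split=> //; first exact: known_frame sb3 _ (known_frame sb2 _ known1).
by apply: vector_frame sb3 _ (vector_frame sb2 _ pivs).
Qed.

Section NextColumns.
Variables (A : store) (a : nat).
Hypotheses (A_sorted : rows_sorted A) (a_lt : a < n).
Notation i := (src a).

Let pivs : holds_vector fPivot piv A. Proof. by case: A_sorted. Qed.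
Let sources : holds_vector fSource src A. Proof. by case: A_sorted. Qed.

Let i_lt : i < n. Proof. exact: source_lt. Qed.

Let evals_i q : evals [:: n; k; a; q] A (entry fSource (EVar 2)) i.
Proof. exact: evals_entry. Qed.

Let evals_q q : evals [:: n; k; a; q] A (EVar 3) q. Proof. by []. Qed.

Let evals_pred q : 0 < q -> evals [:: n; k; a; q] A (EBin ASub (EVar 3) 1) (q - 1).
Proof. by move=> q_gt0; apply: evals_sub => //; apply: evals_cst; lia. Qed.

Lemma evals_row q : q < k.+1 ->
  exists2 v, codes v (enc a q) & evals [:: n; k; a; q] A row_expr v.
Proof.
have [[[tags _ _] [rows _ _]] _ _] := A_sorted.
case: q => [|q] qk; rewrite (enc_src dollar n_gt0 size_T k_lt) //=.
  exists (if is_param (row_last i) then 0 else n + 1 + i).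
    rewrite /front; case last_i: (row_last i) => [s|p] //=.
    by exists i => //; rewrite /front last_i.
  apply: evals_else => //; apply: evals_if; first exact: evals_entry tags _ _ _.
    by move=> _; apply: evals_cst; lia.
  by move=> _; do 2?[apply: evals_add => //]; try (apply: evals_cst); lia.
exists (if q == piv i then q.+1 else A fRow i q).
  by rewrite /backref; case: ifP => // _; apply: rows.
apply: (evals_then _ (evals_q q.+1)) => //.
have ev_q := @evals_pred q.+1 isT; rewrite subn1 /= in ev_q.
apply: evals_if => [|_|_]; [apply: evals_eqn => //; exact: evals_entry|by []|].
by apply: (evals_cell (evals_i _) ev_q); rewrite //= i_lt; lia.
Qed.

Lemma evals_zeros q :
  q < k.+1 -> evals [:: n; k; a; q] A zeros_expr (zeros_upto a q).
Proof.
move=> qk; have [[[tags _ _] [_ zeros_A _]] _ _] := A_sorted.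
have zerosE := zeros_src dollar n_gt0 size_T k_lt a_lt qk.
apply: (evals_eq (v := front_tag i + zeros (mkseq (enc i) q) - (piv i < q))).
  by rewrite /front_tag -front_eq0 -zerosE addnK.
have zeros_le := zeros_mkseq_le (enc i) q.
apply: evals_sub; last by rewrite /front_tag -front_eq0 -zerosE leq_addl.
- apply: evals_add; last by rewrite /front_tag; lia.
    exact: evals_entry tags _ _ _.
  case: q qk zerosE {zeros_le} => [|q] qk _.
    by apply: evals_else => //; apply: evals_cst; lia.
  apply: (evals_then _ (evals_q q.+1)) => //.
  have ev_q := @evals_pred q.+1 isT; rewrite subn1 /= in ev_q.
  by apply: (evals_cell (evals_i _) ev_q); rewrite /= ?i_lt ?zeros_A //; lia.
- by apply: evals_ltn => //; exact: evals_entry.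
Qed.

Lemma evals_next_lcp b : b < n ->
  evals [:: n; k; a; b] A lcp_expr (lcp (enc a) (enc b) k.+1).
Proof.
move=> b_lt; have [[inp cols] _ _] := A_sorted.
have j_lt : src b < n by exact: source_lt.
have ev_j : evals [:: n; k; a; b] A (entry fSource (EVar 3)) (src b).
  exact: evals_entry.
have ev_lcp := evals_lcp cols i_lt j_lt (evals_i b) ev_j.
have ev_pi := evals_entry pivs isT i_lt (evals_i b).
have ev_pj := evals_entry pivs isT j_lt ev_j.
rewrite (lcp_src dollar n_gt0 size_T k_lt a_lt b_lt) /=; set l := if _ then _ else _.
have lk : l <= k.
  by rewrite /l; have := lcp_le (enc i) (enc (src b)) k; case: ifP => _; lia.
apply: evals_mul; [exact: evals_front_eq| |by case: (_ == _); lia].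
apply: evals_add; [|by apply: evals_cst; lia|by lia].
apply: evals_if => [|_|_]; [exact: evals_eqn|exact: ev_lcp|].
by do 2?[apply: evals_min].
Qed.

End NextColumns.

Lemma evals_next_bound rho A :
  evals [:: n, k & rho] A (EBin AAdd (EVar 1) 1) k.+1.
Proof. by rewrite -[k.+1]addn1; apply: evals_add => //; lia. Qed.

Lemma wp_next_columns A : rows_sorted A ->
  wp [:: n; k] next_columns
    (fun A' => holds_input A' /\ holds_columns fNextRow fNextZeros fNextLcp k.+1 A') A.
Proof.
move=> sorted0.
apply: wp_seq.
apply: (wp_fill_matrix (m := k.+1)) => // [i A'|a q A' al qk sb|A1 sb1 rows1].
- exact: evals_next_bound.
- by apply: evals_row al _ qk; apply: rows_sorted_frame sb _ sorted0.
have sorted1 := rows_sorted_frame sb1 isT sorted0.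
apply: wp_seq.
apply: (wp_fill_matrix (m := k.+1) (P := fun a q v => v = zeros_upto a q))
  => // [i A'|a q A' al qk sb|A2 sb2 zeros2].
- exact: evals_next_bound.
- exists (zeros_upto a q) => //; apply: evals_zeros al _ qk.
  exact: rows_sorted_frame sb _ sorted1.
have sorted2 := rows_sorted_frame sb2 isT sorted1.
apply: (wp_fill_matrix (m := n) (P := fun a b v => v = lcp (enc a) (enc b) k.+1))
  => // [a b A' al bl sb|A3 sb3 lcps3].
  exists (lcp (enc a) (enc b) k.+1) => //; apply: evals_next_lcp al _ bl.
  exact: rows_sorted_frame sb _ sorted2.
have [[inp2 _] _ _] := sorted2; split; first exact: input_frame sb3 _ inp2.
split=> //; first exact: matrix_frame sb3 _ (matrix_frame sb2 _ rows1).
exact: matrix_frame sb3 _ zeros2.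
Qed.

Lemma wp_copy_matrix f f' b m P Q A :
  f < num_arrays -> f' < num_arrays -> m <= n -> f.+1 != f'.+1 ->
  (forall i A', evals [:: n; k; i] A' b m) -> holds_matrix f'.+1 m P A ->
  (forall A', same_but f.+1 A A' -> holds_matrix f.+1 m P A' -> Q A') ->
  wp [:: n; k] (fill_matrix 2 f.+1 b (ECell f'.+1 (EVar 2) (EVar 3))) Q A.
Proof.
move=> fK fK' mn ff ev_b held post.
apply: (wp_fill_matrix (m := m) (P := P)) => // i j A' il jm sb.
exists (A f'.+1 i j); first exact: held.
apply: (evals_cell (i := i) (j := j)) => //=; last by rewrite sb // eq_sym.
by rewrite fK' il (leq_trans jm).
Qed.

Lemma wp_copy_back A :
  holds_input A -> holds_columns fNextRow fNextZeros fNextLcp k.+1 A ->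
  wp [:: n; k] copy_back (known k.+1) A.
Proof.
move=> inp0 [rows0 zeros0 lcps0].
apply: wp_seq; apply: (wp_copy_matrix (m := k.+1)) rows0 _ => // [i A'|A1 sb1 rows1].
  exact: evals_next_bound.
have zeros1 := matrix_frame (f' := fNextZeros) sb1 isT zeros0.
have lcps1 := matrix_frame (f' := fNextLcp) sb1 isT lcps0.
apply: wp_seq; apply: (wp_copy_matrix (m := k.+1)) zeros1 _ => // [i A'|A2 sb2 zeros2].
  exact: evals_next_bound.
apply: wp_copy_matrix (matrix_frame sb2 _ lcps1) _ => // A3 sb3 lcps3.
split; first exact: input_frame sb3 _ (input_frame sb2 _ (input_frame sb1 _ inp0)).
split=> //; first exact: matrix_frame sb3 _ (matrix_frame sb2 _ rows1).
exact: matrix_frame sb3 _ zeros2.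
Qed.

Lemma wp_round A : known k A -> wp [:: n; k] round (known k.+1) A.
Proof.
move=> /wp_sort_rows sorts.
apply: wp_seq; apply: wp_mono sorts => A1 /wp_next_columns next.
by apply: wp_seq; apply: wp_mono next => A2 []; apply: wp_copy_back.
Qed.

End Round.

Definition holds_words (X : seq nat) (A : store) : Prop :=
  forall a, a < size X -> A fWords a 0 = nth 0 X a.

Lemma words_frame f X A A' :
  same_but f A A' -> f != fWords -> holds_words X A -> holds_words X A'.
Proof. by move=> sb ne held a /held; rewrite sb // eq_sym. Qed.

Notation input := (ewords (pbwt c0 T)).

Lemma nth_input i : i < n ->
  nth 0 input (2 * i) = front_tag i /\
  nth 0 input (2 * i + 1) =
    if is_param (row_last i) then front_count i else front_rank i.
Proof.
move=> il; have := @nth_words _ _ _ id (inr 0) (pbwt c0 T) i.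
rewrite (size_pbwt dollar size_T) (pbwt_nth dollar n_gt0 size_T il) => /(_ il)[-> ->].
by rewrite /front_tag /front_count /front_rank; case: (row_last i).
Qed.

Lemma evals_cell_words rho A e a X : holds_words X A -> size X = 2 * n ->
  a < 2 * n -> evals rho A e a -> evals rho A (ECell fWords e 0) (nth 0 X a).
Proof.
move=> held sizeX al ev_e; apply: (evals_cell (j := 0) ev_e).
- by apply: evals_cst; lia.
- by rewrite /= al.
- by apply: held; rewrite sizeX.
Qed.

Section LoadInput.
Variables (A : store) (i : nat).
Hypotheses (held : holds_words input A) (il : i < n).

Let size_input : size input = 2 * n.
Proof. by rewrite size_words (size_pbwt dollar size_T). Qed.

Let evals_even : evals [:: n; i] A (EBin AMul 2 (EVar 1)) (2 * i).
Proof. by apply: evals_mul => //; [apply: evals_cst|]; lia. Qed.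

Lemma evals_input_tag : evals [:: n; i] A input_tag (front_tag i).
Proof.
have [<- _] := nth_input il.
by apply: evals_cell_words held size_input _ evals_even; rewrite ltn_mul2l.
Qed.

Lemma evals_input_value :
  evals [:: n; i] A input_value
    (if is_param (row_last i) then front_count i else front_rank i).
Proof.
have [_ <-] := nth_input il.
apply: (evals_cell_words held size_input); first by lia.
by apply: evals_add; [exact: evals_even|apply: evals_cst|]; lia.
Qed.

Lemma evals_symbol :
  evals [:: n; i] A (EIf input_tag 0 input_value) (front_rank i).
Proof.
apply: (evals_eq (v := if is_param (row_last i) then 0 else front_rank i)).
  by rewrite /front_rank; case: (row_last i).
apply: evals_if => [|_|static]; first exact: evals_input_tag.
  by apply: evals_cst; lia.
by have := evals_input_value; rewrite (negPf static).
Qed.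

Lemma evals_count :
  evals [:: n; i] A (EIf input_tag input_value (EBin AAdd (EVar 0) 1)) (front_count i).
Proof.
apply: (evals_eq (v := if is_param (row_last i) then front_count i else n + 1)).
  by rewrite /front_count; case: is_param; rewrite ?addn1.
apply: evals_if => [|param|_]; first exact: evals_input_tag.
  by have := evals_input_value; rewrite param.
by apply: evals_add => //; lia.
Qed.

End LoadInput.

Lemma wp_load_input A :
  holds_words input A -> holds_matrix fLcp n (fun _ _ v => v = 0) A ->
  wp [:: n] load_input (known 0) A.
Proof.
move=> words0 lcps0.
apply: wp_seq; apply: wp_fill_vector => // [i A' il sb _|A1 sb1 tags].
  by apply: evals_input_tag il; apply: words_frame sb _ words0.
have words1 := words_frame sb1 isT words0.
apply: wp_seq; apply: wp_fill_vector => // [i A' il sb _|A2 sb2 symbols].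
  by apply: evals_symbol il; apply: words_frame sb _ words1.
have words2 := words_frame sb2 isT words1.
apply: wp_fill_vector => // [i A' il sb _|A3 sb3 counts].
  by apply: evals_count il; apply: words_frame sb _ words2.
split; split=> //.
- exact: vector_frame sb3 _ (vector_frame sb2 _ tags).
- exact: vector_frame sb3 _ symbols.
- move=> i j il jl; have := lcp_le (enc i) (enc j) 0; rewrite leqn0 => /eqP->.
  by rewrite sb3 // sb2 // sb1 // lcps0.
Qed.

Lemma wp_rounds A : known 0 A -> wp [:: n] (SFor (EVar 0) round) (known n) A.
Proof. by move=> known0; exists n, known; split=> // k A' k_lt /(wp_round k_lt). Qed.

Hypothesis dollar_min : forall s : Ss, (dollar <= s)%O.
Hypothesis T_dollar : forall q, q < n -> (nth c0 T q == c0) = (q.+1 == n).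

Notation beg := (start T).

Let beg_lt : beg < n. Proof. exact: start_lt. Qed.

Lemma enum_rank_dollar (s : Ss) : (Order.enum_rank s == 0 :> nat) = (s == dollar).
Proof.
have rank0 : Order.enum_rank dollar = 0 :> nat.
  have card_gt0 : 0 < #|Ss| by apply/card_gt0P; exists dollar.
  pose least : Ss := Order.enum_val (Ordinal card_gt0).
  have := Order.le_enum_rank (@le_total _ Ss) dollar least.
  by rewrite /least dollar_min Order.enum_valK leEord leqn0 => /eqP.
by rewrite -rank0 -(inj_eq (@Order.enum_rank_inj _ _)).
Qed.

Lemma front_zero_start i :
  i < n -> (front_tag i == 0) && (front_rank i == 0) = (i == beg).
Proof.
move=> il; rewrite -(front_start n_gt0 size_T T_dollar il).
rewrite /front_tag /front_rank /front.
by case: (row_last i) => [s|p] //=; rewrite enum_rank_dollar.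
Qed.

Lemma evals_start A : holds_input A -> evals [:: n] A start_expr beg.
Proof.
move=> [tags symbols _].
pose front_zero i := (front_tag i == 0) && (front_rank i == 0).
have begE : \sum_(i < n) i * front_zero i = beg.
  apply: (@sum_pick n id front_zero) => //.
    by rewrite /front_zero front_zero_start.
  by move=> j jl; rewrite /front_zero front_zero_start // => /eqP.
apply: (evals_eq begE).
apply: (evals_sum (m := n) (F := fun i => i * front_zero i)) => //; last first.
  by rewrite begE; lia.
move=> i il; apply: evals_mul => //; last by case: (front_zero i); lia.
have ev0 : evals [:: n; i] A 0 0 by apply: evals_cst; lia.
by apply: evals_and => //; apply: evals_eqn => //; exact: evals_entry.
Qed.

Definition started (A : store) : Prop := known n A /\ A fStart 0 0 = beg.

Lemma started_frame f A A' : same_but f A A' ->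
  f \notin [:: fTag; fSymbol; fCount; fRow; fZeros; fLcp; fStart] ->
  started A -> started A'.
Proof.
move=> sb f_other [kA startA]; split.
  by apply: known_frame sb _ kA; move: f_other; rewrite !inE; lia.
by rewrite sb //; move: f_other; rewrite !inE; lia.
Qed.

Lemma wp_start A : known n A -> wp [:: n] (SStore fStart 0 0 start_expr) started A.
Proof.
move=> kA; have ev0 : evals [:: n] A 0 0 by apply: evals_cst; lia.
exists 0, 0, beg; split=> //; first by apply: evals_start; case: kA.
by rewrite /= n_gt0.
Qed.

Definition name (q : nat) : nat :=
  if nth c0 T q is inr p then Order.enum_rank (rename T p) else 0.

Section StartRow.
Variables (A : store) (q : nat).
Hypotheses (A_started : started A) (ql : q < n).

Lemma evals_start_cell f v :
  f < num_arrays -> A f.+1 beg q = v -> evals [:: n; q] A (start_cell f.+1) v.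
Proof.
move=> fK Av; have [_ startA] := A_started.
apply: (evals_cell (i := beg) (j := q)) => //; last by rewrite /= fK beg_lt ql.
have ev0 : evals [:: n; q] A 0 0 by apply: evals_cst; lia.
by apply: (evals_cell ev0 ev0) => //; rewrite /= n_gt0.
Qed.

Lemma codes_start : codes (A fRow beg q) (enc beg q).
Proof. by have [[_ [rows _ _]] _] := A_started; exact: rows. Qed.

Lemma evals_name :
  (forall q', q' < q -> A fName q' 0 = name q') -> evals [:: n; q] A name_expr (name q).
Proof.
move=> named; have [[_ [_ zeros_A _]] _] := A_started.
have ev_x := @evals_start_cell fRow.-1 _ isT erefl; rewrite /= in ev_x.
have ev_n : evals [:: n; q] A (EVar 0) n by [].
have ev0 : evals [:: n; q] A 0 0 by apply: evals_cst; lia.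
have := enc_startP dollar n_gt0 size_T ql; have := codes_start.
case e: (enc beg q) => [s|[|v]] /=.
- move=> [i il [x_eq _]] Tq; rewrite x_eq in ev_x; rewrite /name Tq.
  apply: (evals_then _ ev_x); first by lia.
  by apply: (evals_then _ (evals_ltn _ ev_n ev_x)) => //; rewrite lt0b; lia.
- move=> x_eq; rewrite x_eq in ev_x; case Tq: (nth c0 T q) => [|p] // _.
  apply: evals_else ev_x _; rewrite /name Tq (rename_first n_gt0 size_T ql Tq e).
  have zeros_gt0 : 0 < zeros_upto beg q.
    by rewrite /zeros_upto zeros_mkseqS e eqxx addn1.
  by apply: evals_sub => //; apply: evals_start_cell => //; exact: zeros_A.
move=> x_eq _; rewrite x_eq in ev_x; apply: (evals_then _ ev_x) => //.
have [vq Tq] := enc_back dollar n_gt0 size_T ql e isT.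
have ev_cmp := evals_ltn B_gt1 ev_n ev_x.
rewrite ltnNge (leq_trans vq (ltnW ql)) /= in ev_cmp.
apply: evals_else ev_cmp _; apply: (evals_cell (i := q - v.+1) (j := 0)) => //.
- by apply: evals_sub.
- by rewrite /= (leq_ltn_trans (leq_subr _ _) ql) n_gt0.
- by rewrite named ?/name ?Tq //; lia.
Qed.

Lemma evals_output_tag : evals [:: n; q] A output_tag (is_param (nth c0 T q)).
Proof.
have ev_x := @evals_start_cell fRow.-1 _ isT erefl.
apply: (evals_eq (v := A fRow beg q < n + 1)).
  congr nat_of_bool; have := enc_startP dollar n_gt0 size_T ql; have := codes_start.
  case e: (enc beg q) => [s|v] /=; first by move=> [i il [-> _]] -> /=; lia.
  have := enc_bounded dollar size_T (leqnn n) ql e.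
  by move=> vq -> ->; lia.
by apply: evals_ltn => //; apply: evals_add => //; lia.
Qed.

Lemma evals_output_value : A fName q 0 = name q ->
  evals [:: n; q] A output_value
    (if nth c0 T q is inl s then Order.enum_rank s : nat else name q).
Proof.
move=> named; have [[[_ symbols _] _] _] := A_started.
have ev_x := @evals_start_cell fRow.-1 _ isT erefl; rewrite /= in ev_x.
have ev_n : evals [:: n; q] A (EVar 0) n by [].
have := enc_startP dollar n_gt0 size_T ql; have := codes_start.
case e: (enc beg q) => [s|v] /=.
  move=> [i il [x_eq front_i]] ->; rewrite x_eq in ev_x.
  apply: (evals_then _ (evals_ltn B_gt1 ev_n ev_x)); first by rewrite lt0b; lia.
  apply: (evals_eq (v := front_rank i)).
    by move: front_i; rewrite /front /front_rank; case: (row_last i) => [s'|p] //= [->].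
  apply: evals_entry symbols _ il _ => //.
  apply: (evals_eq (addKn (n + 1) i)); apply: evals_sub ev_x _ (leq_addr _ _).
  by apply: evals_add => //; lia.
have := enc_bounded dollar size_T (leqnn n) ql e => vq x_eq.
rewrite x_eq in ev_x; case: (nth c0 T q) => [|p] // _.
have ev_cmp := evals_ltn B_gt1 ev_n ev_x.
rewrite ltnNge (leq_trans vq (ltnW ql)) /= in ev_cmp; apply: evals_else ev_cmp _.
apply: (evals_cell (i := q) (j := 0)) => //; first by apply: evals_cst; lia.
by rewrite /= ql n_gt0.
Qed.

End StartRow.

Notation renamed := [seq psubst (rename T) c | c <- T].
Notation rank_code := (fun p : Sp => Order.enum_rank p : nat).

Definition written (q : nat) (A : store) : Prop :=
  A fWords (2 * q) 0 = is_param (nth c0 T q) /\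
  A fWords (2 * q + 1) 0 =
    if nth c0 T q is inl s then Order.enum_rank s : nat else name q.

Lemma written_words A :
  (forall q, q < n -> written q A) -> holds_words (pwords renamed) A.
Proof.
move=> A_written a; rewrite size_words size_map size_T => al.
have [q ql a_q] : exists2 q, q < n & a = 2 * q \/ a = 2 * q + 1.
  by exists (a %/ 2); lia.
have := @nth_words _ _ _ rank_code c0 renamed q.
rewrite size_map size_T => /(_ ql)[]; rewrite (nth_map c0) ?size_T // => tag value.
have [A_tag A_value] := A_written _ ql.
case: a_q => -> {al}; first by rewrite A_tag [RHS]tag; case: (nth c0 T q).
by rewrite A_value [RHS]value /name; case: (nth c0 T q).
Qed.

Lemma wp_write_output A : started A -> holds_vector fName name A ->
  wp [:: n] write_output (holds_words (pwords renamed)) A.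
Proof.
move=> startedA namesA.
exists n, (fun m A' => same_but fWords A A' /\ forall q, q < m -> written q A').
split=> // [q A' ql [sb writtenA']|A' [_ /written_words] //].
have ev0 (A1 : store) : evals [:: n; q] A1 0 0 by apply: evals_cst; lia.
have ev_even (A1 : store) : evals [:: n; q] A1 (EBin AMul 2 (EVar 1)) (2 * q).
  by apply: evals_mul => //; [apply: evals_cst|]; lia.
apply: wp_seq; exists (2 * q), 0, (is_param (nth c0 T q)); split=> //.
- by apply: evals_output_tag ql; apply: started_frame sb _ startedA.
- by rewrite /= ltn_mul2l ql.
set A1 := set_cell A' _ _ _ _; have sb1 : same_but fWords A A1 by exact: same_but_set.
exists (2 * q + 1), 0.
exists (if nth c0 T q is inl s then Order.enum_rank s : nat else name q); split=> //.
- by apply: evals_add => //; lia.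
- apply: (evals_output_value _ ql); first exact: started_frame sb1 _ startedA.
  by rewrite sb1 // namesA.
- by rewrite /=; lia.
split=> [|q']; first exact: same_but_set.
rewrite ltnS leq_eqVlt => /orP[/eqP->|q'q].
  by split; rewrite /A1 /set_cell !eqxx //= ifN //; lia.
have [tag' value'] := writtenA' _ q'q.
by split; rewrite /A1 /set_cell /= !andbT !ifN //; lia.
Qed.

Lemma wp_inversion A :
  holds_words input A -> holds_matrix fLcp n (fun _ _ v => v = 0) A ->
  wp [:: n] inversion (holds_words (pwords renamed)) A.
Proof.
move=> words0 lcps0.
apply: wp_seq; apply: wp_mono (wp_load_input words0 lcps0) => A1 known1.
apply: wp_seq; apply: wp_mono (wp_rounds known1) => A2 known2.
apply: wp_seq; apply: wp_mono (wp_start known2) => A3 started3.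
apply: wp_seq; apply: wp_fill_vector => // [q A' ql sb named|A4 sb4 names4].
  by apply: evals_name => //; apply: started_frame sb _ started3.
by apply: wp_write_output names4; apply: started_frame sb4 _ started3.
Qed.

Lemma front_count_le i : front_count i <= n.+1.
Proof.
rewrite /front_count; case: ifP => // _; apply: leqW.
apply: leq_trans (zeros_mkseq_le _ _) _.
by rewrite -(size_row size_T i) index_mem (row_last_in _ n_gt0 size_T).
Qed.

Lemma input_lt a : #|Ss| <= B -> nth 0 input a < B.
Proof.
move=> symbols_fit; have B_gt0 := ltnW B_gt1.
have [al|al] := ltnP a (2 * n); last first.
  by rewrite nth_default // size_words (size_pbwt dollar size_T).
have [i il a_i] : exists2 i, i < n & a = 2 * i \/ a = 2 * i + 1 by exists (a %/ 2); lia.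
have [tag value] := nth_input il; case: a_i => ->; first by rewrite tag bool_lt.
rewrite value; case: ifP => _; first by have := front_count_le i; lia.
rewrite /front_rank; case: (row_last i) => // s.
exact: leq_trans (ltn_ord _) symbols_fit.
Qed.

Definition initial_store : store := fun f i j => nth 0 input (addr num_arrays n f i j).

Lemma wp_inversion_initial :
  wp [:: n] inversion (holds_words (pwords renamed)) initial_store.
Proof.
apply: wp_inversion => // i j _ _; rewrite /initial_store nth_default //.
by rewrite size_words (size_pbwt dollar size_T) leq_addr.
Qed.

End Correctness.

Lemma runs_within_weaken w P T T' sp st (Q Q' : state -> Prop) :
  T <= T' -> (forall st', Q st' -> Q' st') ->
  runs_within w P T sp st Q -> runs_within w P T' sp st Q'.
Proof.
move=> TT' QQ' [t [tT halt acc q]]; exists t; split=> //; last exact: QQ'.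
exact: leq_trans TT'.
Qed.

Lemma store_rel_outputs (ds dp : Order.disp_t) (Ss : finOrderType ds)
    (Sp : finOrderType dp) w K n A st (X : seq (psym Ss Sp)) :
  size X = n -> store_rel w K n A (memory st) -> holds_words (pwords X) A ->
  outputs X st.
Proof.
move=> size_X represented words_A.
apply: (@eq_from_nth _ 0); rewrite size_mkseq // => a al.
rewrite nth_mkseq // -words_A //; have [|<- _] := represented 0 a 0 => //.
by move: al; rewrite /= size_words size_X => ->.
Qed.

Theorem inversion_runs (ds dp : Order.disp_t) (Ss : finOrderType ds)
    (Sp : finOrderType dp) (dollar : Ss) (n w sp : nat) (T : seq (psym Ss Sp)) :
  (forall s, (dollar <= s)%O) -> 0 < n -> size T = n ->
  (forall q, q < n -> (nth (inl dollar) T q == inl dollar) = (q.+1 == n)) ->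
  2 * n + n * n * num_arrays <= sp -> 4 * n + 20 <= sp -> sp <= 2 ^ w ->
  #|Ss| <= 2 ^ w ->
  runs_within w (compile num_arrays inversion) (stmt_time n inversion) sp
    (init (pbwt (inl dollar) T))
    (fun st => exists2 T', pmatch T T' & outputs T' st).
Proof.
move=> dollar_min n_gt0 size_T T_dollar cells_le sp_ge sp_le symbols_fit.
have B_ge := leq_trans sp_ge sp_le.
have initial_rel : store_rel w num_arrays n (initial_store dollar n T)
    (nth 0 (ewords (pbwt (inl dollar) T))).
  by move=> f i j _; split=> //; exact: (input_lt dollar n_gt0 size_T B_ge).
apply: runs_within_weaken (leqnn _) _ (compile_correct _ _ _ sp_le cells_le _
  initial_rel (wp_inversion_initial n_gt0 size_T B_ge dollar_min T_dollar));
  try by [lia|rewrite /= (size_pbwt dollar size_T)].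
move=> st [A words_A represented]; exists [seq psubst (rename T) c | c <- T].
  by exists (rename T) => //; exact: rename_bij.
by apply: store_rel_outputs represented words_A; rewrite size_map.
Qed.

Theorem theorem1 :
  exists (P : seq instr) (C : nat),
  forall (ds dp : Order.disp_t) (Ss : finOrderType ds) (Sp : finOrderType dp)
    (dollar : Ss) (dollar_min : forall s : Ss, (dollar <= s)%O)
    (n : nat) (n_gt0 : 0 < n) (T : n.-tuple (psym Ss Sp))
    (T_dollar : forall i : 'I_n, tnth T i = inl dollar <-> i.+1 = n)
    (L : seq (ecode Ss)) (L_pbwt : L = pbwt (inl dollar) T)
    (w : nat) (addressable : C * n ^ 2 <= 2 ^ w) (symbols_fit : #|Ss| <= 2 ^ w),
  runs_within w P (C * n ^ 3) (C * n ^ 2) (init L)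
    (fun st => exists2 T' : seq (psym Ss Sp), pmatch T T' & outputs T' st).
Proof.
exists (compile num_arrays inversion), (stmt_time 1 inversion + 40).
move=> ds dp Ss Sp dollar dollar_min n n_gt0 T T_dollar L -> w.
have := leq_stmt_time n_gt0 inversion; rewrite inversion_deg.
move: (stmt_time 1 inversion) => c time_le addressable symbols_fit.
have n_le_sq : n <= n ^ 2 by rewrite -mulnn leq_pmulr.
have cells_le : 40 * n ^ 2 <= (c + 40) * n ^ 2 by rewrite leq_mul2r leq_addl orbT.
have T_dollar' q : q < n -> (nth (inl dollar) T q == inl dollar) = (q.+1 == n).
  move=> ql; have := T_dollar (Ordinal ql); rewrite (tnth_nth (inl dollar)).
  by move=> dollar_iff; apply/eqP/eqP => /dollar_iff.
apply: runs_within_weaken (inversion_runs dollar_min n_gt0 (size_tuple T) T_dollar'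
  _ _ addressable symbols_fit) => //; rewrite ?mulnn; lia.
Qed.
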